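(* Let $\mathrm{R}$ be a real closed field, $d \geq 2$, and let $\mathcal{P} \subset \mathrm{R}[X_1,\ldots,X_n]_{\leq d}$ and $\mathcal{P}_f, \mathcal{P}_g \subset \mathrm{R}[X_1,\ldots,X_n,Y]_{\leq d}$ be finite sets of polynomials. Let $A \subset \mathrm{R}^n$ be a closed $\mathcal{P}$-semi-algebraic set, and let $f,g: A \rightarrow \mathrm{R}$ be continuous semi-algebraic functions whose graphs are a $\mathcal{P}_f$-semi-algebraic set, respectively a $\mathcal{P}_g$-semi-algebraic set, and such that $f^{-1}(0) \subset g^{-1}(0)$. Then there exist $N = (8 d)^{2(n+7)}$ and a continuous semi-algebraic function $h:A \rightarrow \mathrm{R}$ such that $g^N = h f$ on $A$.
   Context: $\mathrm{R}[\ldots]_{\le d}$ denotes polynomials of degree at most $d$. For a finite set of polynomials $\mathcal{P}$, a $\mathcal{P}$-semi-algebraic set is the set of points satisfying a quantifier-free formula whose atoms are of the form $P=0$, $P>0$, $P<0$ with $P \in \mathcal{P}$. *)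

(* Defs.v *)
From HB Require Import structures.
From mathcomp Require Import all_boot all_order all_algebra.
From mathcomp Require Import mpoly.
Set Implicit Arguments. Unset Strict Implicit. Unset Printing Implicit Defensive.
Import Order.TTheory GRing.Theory Num.Theory.
Local Open Scope ring_scope.

Notation point R n := ('I_n -> R).

Inductive qf_formula (R : rcfType) (n : nat) : Type :=
  | QTrue
  | QEq0 of {mpoly R[n]}
  | QGt0 of {mpoly R[n]}
  | QLt0 of {mpoly R[n]}
  | QNot of qf_formula R n
  | QAnd of qf_formula R n & qf_formula R n
  | QOr of qf_formula R n & qf_formula R n.

Fixpoint qf_atoms (R : rcfType) (n : nat) (phi : qf_formula R n) : seq {mpoly R[n]} :=
  match phi with
  | QTrue => [::]
  | QEq0 p | QGt0 p | QLt0 p => [:: p]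
  | QNot a => qf_atoms a
  | QAnd a b | QOr a b => qf_atoms a ++ qf_atoms b
  end.

Fixpoint qf_holds (R : rcfType) (n : nat) (phi : qf_formula R n) (x : point R n) : Prop :=
  match phi with
  | QTrue => True
  | QEq0 p => p.@[x] = 0
  | QGt0 p => 0 < p.@[x]
  | QLt0 p => p.@[x] < 0
  | QNot a => ~ qf_holds a x
  | QAnd a b => qf_holds a x /\ qf_holds b x
  | QOr a b => qf_holds a x \/ qf_holds b x
  end.

Definition is_P_semialg (R : rcfType) (n : nat) (P : seq {mpoly R[n]})
  (S : point R n -> Prop) : Prop :=
  exists phi : qf_formula R n,
    {subset qf_atoms phi <= P} /\ forall x, S x <-> qf_holds phi x.

Definition is_semialg (R : rcfType) (n : nat) (S : point R n -> Prop) : Prop :=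
  exists P : seq {mpoly R[n]}, is_P_semialg P S.

Definition deg_le (R : rcfType) (n : nat) (P : seq {mpoly R[n]}) (d : nat) : Prop :=
  forall p, p \in P -> (msize p <= d.+1)%N.

(* Euclidean topology on R^n (via the equivalent max-norm balls). *)
Definition near_pt (R : rcfType) (n : nat) (delta : R) (x y : point R n) : Prop :=
  forall i, `|x i - y i| < delta.

Definition is_closed (R : rcfType) (n : nat) (A : point R n -> Prop) : Prop :=
  forall x, (forall delta : R, 0 < delta -> exists y, A y /\ near_pt delta x y) -> A x.

Definition continuous_on (R : rcfType) (n : nat) (A : point R n -> Prop)
  (f : point R n -> R) : Prop :=
  forall x, A x -> forall eps : R, 0 < eps ->
    exists2 delta : R, 0 < delta &
      forall y, A y -> near_pt delta x y -> `|f y - f x| < eps.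

Definition graph_on (R : rcfType) (n : nat) (A : point R n -> Prop)
  (f : point R n -> R) : point R n.+1 -> Prop :=
  fun z => A (fun i => z (widen_ord (leqnSn n) i)) /\
           z ord_max = f (fun i => z (widen_ord (leqnSn n) i)).

(* Main.v *)
Require Import Defs.
From HB Require Import structures.
From mathcomp Require Import all_boot all_order all_algebra.
From mathcomp Require Import mpoly.
From mathcomp Require Import ring lra zify.
From mathcomp.real_closed Require ordered_qelim qe_rcf.
From mathcomp.real_closed Require Import polyrcf.
From Stdlib Require Import Classical FunctionalExtensionality.
Import Order.TTheory GRing.Theory Num.Theory.
Local Open Scope ring_scope.
Set Implicit Arguments. Unset Strict Implicit. Unset Printing Implicit Defensive.

(** Take [h := g ^ N / f], extended by [0] where [f] vanishes.  Everything reduces to an inequality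
    [c * |g| ^ tau <= |f|] with [tau < N] near each zero [x0] of [f].

    Fix a value [t <> 0] of [g] and let [u] be a value of [f] of least modulus on the compact set of
    the [x] in [A] close to [x0] with [g x = t].  Such a minimum is a limit, as [zeta] tends to [0],
    of critical points [y = (x, u)] of
    [F (y, t) + zeta * u ^ 2 + zeta ^ 2 * sum_i y_i ^ (2 d + 2)], where [F] is the sum of the squares
    of the polynomials of degree at most [d] that vanish at the minimiser.  The critical equations
    express [zeta ^ 2 * y_i ^ (2 d + 1)] by terms of lower degree, so that modulo these equations
    all the [zeta ^ a * u ^ a] lie in the span of the [B = (2 d + 1) ^ (n + 1)] monomials of degree
    at most [2 d] in each [y_i], with coefficients of controlled degree in [t] and [zeta].
    Counting dimensions yields a relation between [zeta], [u] and [t] of degree less than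
    [tau = 2 (2 d + 1) B ^ 2] in [t]; its part of lowest order in [zeta] is a nonzero [Q] with
    [Q (t, u) = 0], and hence [|u| >= c * |t| ^ tau] for small [t].  There are finitely many possible
    [F], so [c] can be chosen uniformly.  Compactness over a real closed field comes from quantifier
    elimination, which gives infima of semialgebraic subsets of the line. *)

(** * Semialgebraic sets *)

Section Semialgebraic.
Variable R : rcfType.

Definition front n (z : point R n.+1) : point R n :=
  fun i => z (widen_ord (leqnSn n) i).
Definition ext n (x : point R n) (r : R) : point R n.+1 :=
  fun i => oapp x r (insub (val i)).

Lemma ext_widen n (x : point R n) r i : ext x r (widen_ord (leqnSn n) i) = x i.
Proof. by rewrite /ext /= valK. Qed.

Lemma ext_max n (x : point R n) r : ext x r ord_max = r.
Proof. by rewrite /ext /= insubF // ltnn. Qed.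

Lemma front_ext n (x : point R n) r : front (ext x r) = x.
Proof. by apply: functional_extensionality => i; rewrite /front ext_widen. Qed.

Lemma ord_widenP n (P : 'I_n.+1 -> Prop) :
  (forall i, P (widen_ord (leqnSn n) i)) -> P ord_max -> forall i, P i.
Proof.
move=> Pw Pm i; case: (ltnP i n) => [lt_in|le_ni].
  by have := Pw (Ordinal lt_in); congr P; apply: val_inj.
suff -> : i = ord_max by [].
by apply: val_inj => /=; apply/eqP; rewrite eqn_leq le_ni -ltnS ltn_ord.
Qed.

Lemma ext_front n (z : point R n.+1) : ext (front z) (z ord_max) = z.
Proof.
apply: functional_extensionality; apply: ord_widenP => [i|].
  by rewrite ext_widen.
by rewrite ext_max.
Qed.

(** Polynomiality is a property of the function, so that the closure lemmas apply to functions
    written as plain terms and no polynomial has to be exhibited. *)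
Definition polyfun n (F : point R n -> R) :=
  exists p : {mpoly R[n]}, forall x, F x = p.@[x].

Lemma polyfun_meval n (p : {mpoly R[n]}) : polyfun (fun x => p.@[x]).
Proof. by exists p. Qed.

Lemma polyfun_const n (c : R) : polyfun (fun _ : point R n => c).
Proof. by exists c%:MP => x; rewrite mevalC. Qed.

Lemma polyfun_coord n (i : 'I_n) : polyfun (fun x : point R n => x i).
Proof. by exists 'X_i => x; rewrite mevalXU. Qed.

Lemma polyfunD n (F G : point R n -> R) :
  polyfun F -> polyfun G -> polyfun (fun x => F x + G x).
Proof. by move=> [p hp] [q hq]; exists (p + q) => x; rewrite mevalD hp hq. Qed.

Lemma polyfunM n (F G : point R n -> R) :
  polyfun F -> polyfun G -> polyfun (fun x => F x * G x).
Proof. by move=> [p hp] [q hq]; exists (p * q) => x; rewrite mevalM hp hq. Qed.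

Lemma polyfunN n (F : point R n -> R) : polyfun F -> polyfun (fun x => - F x).
Proof. by move=> [p hp]; exists (- p) => x; rewrite mevalN hp. Qed.

Lemma polyfunX n (F : point R n -> R) k :
  polyfun F -> polyfun (fun x => F x ^+ k).
Proof. by move=> [p hp]; exists (p ^+ k) => x; rewrite rmorphXn /= hp. Qed.

Lemma polyfun_sum n (I : Type) (r : seq I) (F : I -> point R n -> R) :
  (forall i, polyfun (F i)) -> polyfun (fun x => \sum_(i <- r) F i x).
Proof.
move=> hF; elim: r => [|i r IH].
  by case: (polyfun_const n 0) => p hp; exists p => x; rewrite big_nil.
case: (polyfunD (hF i) IH) => p hp; exists p => x.
by rewrite big_cons -hp.
Qed.

Lemma polyfun_comp n m (F : point R n -> R) (a : point R m -> point R n) :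
  polyfun F -> (forall i, polyfun (fun x => a x i)) ->
  polyfun (fun x => F (a x)).
Proof.
move=> [p hp] ha.
(* Only one polynomial per coordinate has to be chosen, so induction on [n] replaces an axiom of
   choice. *)
have [q hq] : exists q : n.-tuple {mpoly R[m]},
    forall i x, a x i = (tnth q i).@[x].
  suff [q hq] : exists q : 'I_n -> {mpoly R[m]}, forall i x, a x i = (q i).@[x].
    by exists [tuple q i | i < n] => i x; rewrite tnth_mktuple.
  elim: n {F p hp} a ha => [|n IHn] a ha.
    by exists (fun=> 0) => -[].
  have [q hq] := IHn (fun x i => a x (lift ord0 i)) (fun i => ha (lift ord0 i)).
  have [q0 hq0] := ha ord0.
  exists (fun i => oapp q q0 (unlift ord0 i)) => i x.
  by case: (unliftP ord0 i) => [j ->|->] /=.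
exists (p \mPo q) => x; rewrite comp_mpoly_meval hp.
by apply: meval_eq => i; rewrite hq.
Qed.

Lemma sa_equiv n (S T : point R n -> Prop) :
  (forall x, S x <-> T x) -> is_semialg S -> is_semialg T.
Proof.
move=> eST [P [phi [sub hphi]]]; exists P, phi; split=> // x.
by rewrite -eST.
Qed.

Lemma sa_holds n (phi : qf_formula R n) : is_semialg (qf_holds phi).
Proof. by exists (qf_atoms phi), phi; split. Qed.

Lemma saE n (S : point R n -> Prop) :
  is_semialg S <-> exists phi : qf_formula R n, forall x, S x <-> qf_holds phi x.
Proof.
split=> [[P [phi [_ h]]]|[phi h]]; first by exists phi.
by exists (qf_atoms phi), phi; split.
Qed.

Lemma saT n : is_semialg (fun _ : point R n => True).
Proof. exact: (sa_holds (QTrue R n)). Qed.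

Lemma sa_and n (S T : point R n -> Prop) :
  is_semialg S -> is_semialg T -> is_semialg (fun x => S x /\ T x).
Proof.
by rewrite !saE => -[p hp] [q hq]; exists (QAnd p q) => x /=; rewrite hp hq.
Qed.

Lemma sa_or n (S T : point R n -> Prop) :
  is_semialg S -> is_semialg T -> is_semialg (fun x => S x \/ T x).
Proof.
by rewrite !saE => -[p hp] [q hq]; exists (QOr p q) => x /=; rewrite hp hq.
Qed.

Lemma sa_not n (S : point R n -> Prop) :
  is_semialg S -> is_semialg (fun x => ~ S x).
Proof. by rewrite !saE => -[p hp]; exists (QNot p) => x /=; rewrite hp. Qed.

Lemma sa_imp n (S T : point R n -> Prop) :
  is_semialg S -> is_semialg T -> is_semialg (fun x => S x -> T x).
Proof.
move=> hS hT; apply: sa_equiv (sa_or (sa_not hS) hT) => x.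
by split=> [[nS /nS|]|] // h; case: (classic (S x)) => [/h|]; [right|left].
Qed.

Lemma sa_lt n (F G : point R n -> R) :
  polyfun F -> polyfun G -> is_semialg (fun x => F x < G x).
Proof.
move=> [p hp] [q hq]; apply: sa_equiv (sa_holds (QLt0 (p - q))) => x /=.
by rewrite mevalB subr_lt0 hp hq.
Qed.

Lemma sa_eq n (F G : point R n -> R) :
  polyfun F -> polyfun G -> is_semialg (fun x => F x = G x).
Proof.
move=> [p hp] [q hq]; apply: sa_equiv (sa_holds (QEq0 (p - q))) => x /=.
by rewrite mevalB hp hq; split=> [/eqP|->]; rewrite ?subrr // subr_eq0 => /eqP.
Qed.

Lemma sa_le n (F G : point R n -> R) :
  polyfun F -> polyfun G -> is_semialg (fun x => F x <= G x).
Proof.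
move=> hF hG; apply: sa_equiv (sa_not (sa_lt hG hF)) => x.
by rewrite real_leNgt ?num_real //; split=> [/negP|/negP].
Qed.

Lemma sa_all_seq n (T : eqType) (r : seq T) (S : T -> point R n -> Prop) :
  (forall i, is_semialg (S i)) ->
  is_semialg (fun x => forall i, i \in r -> S i x).
Proof.
move=> hS; elim: r => [|i r IH]; first exact: sa_equiv (saT n).
apply: sa_equiv (sa_and (hS i) IH) => x; split=> [[h0 h] j|h].
  by rewrite in_cons => /orP[/eqP->|/h].
by split=> [|j jr]; apply: h; rewrite in_cons ?eqxx // jr orbT.
Qed.

Lemma sa_all_fin n (T : finType) (S : T -> point R n -> Prop) :
  (forall i, is_semialg (S i)) -> is_semialg (fun x => forall i, S i x).
Proof.
move=> hS; apply: sa_equiv (sa_all_seq (enum T) hS) => x.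
by split=> h i *; apply: h; rewrite ?mem_enum.
Qed.

(** Substitution of polynomials covers every permutation, omission and duplication of variables that
    is needed under a quantifier. *)
Lemma sa_comp n m (S : point R n -> Prop) (a : point R m -> point R n) :
  is_semialg S -> (forall i, polyfun (fun x => a x i)) ->
  is_semialg (fun x => S (a x)).
Proof.
move=> /saE[phi hphi] ha.
apply: (@sa_equiv _ (fun x => qf_holds phi (a x))) => [x|]; first by rewrite hphi.
elim: phi {S hphi} => /=.
- exact: saT.
- move=> p; apply: sa_eq; [exact: polyfun_comp (polyfun_meval p) ha|exact: polyfun_const].
- move=> p; apply: sa_lt; [exact: polyfun_const|exact: polyfun_comp (polyfun_meval p) ha].
- move=> p; apply: sa_lt; [exact: polyfun_comp (polyfun_meval p) ha|exact: polyfun_const].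
- by move=> phi; apply: sa_not.
- by move=> phi IH1 psi IH2; apply: sa_and.
- by move=> phi IH1 psi IH2; apply: sa_or.
Qed.

(* Only used on terms without [GRing.Inv]. *)
Fixpoint term_mpoly k (t : GRing.term R) : {mpoly R[k]} :=
  match t with
  | GRing.Var i => oapp (fun j : 'I_k => 'X_j) 0 (insub i)
  | GRing.Const c => c%:MP
  | GRing.NatConst m => m%:R
  | GRing.Add a b => term_mpoly k a + term_mpoly k b
  | GRing.Opp a => - term_mpoly k a
  | GRing.NatMul a m => term_mpoly k a *+ m
  | GRing.Mul a b => term_mpoly k a * term_mpoly k b
  | GRing.Inv _ => 0
  | GRing.Exp a m => term_mpoly k a ^+ m
  end.

Definition env k (x : point R k) : seq R := [seq x i | i <- enum 'I_k].

Lemma nth_env k (x : point R k) i : nth 0 (env x) i = oapp x 0 (insub i).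
Proof.
case: insubP => [j lt_ik <-|nlt] /=.
  by rewrite (nth_map j) ?size_enum_ord ?ltn_ord // nth_ord_enum.
by rewrite nth_default // size_map size_enum_ord leqNgt.
Qed.

Lemma eval_term_mpoly k (x : point R k) (t : GRing.term R) :
  GRing.rterm t -> (term_mpoly k t).@[x] = GRing.eval (env x) t.
Proof.
elim: t => //=.
- move=> i _; rewrite nth_env.
  by case: insubP => [j _ _|_] /=; rewrite ?mevalXU ?meval0.
- by move=> c _; rewrite mevalC.
- by move=> m _; rewrite rmorph_nat.
- by move=> a IHa b IHb /andP[/IHa ha /IHb hb]; rewrite mevalD ha hb.
- by move=> a IHa /IHa ha; rewrite mevalN ha.
- by move=> a IHa m /IHa ha; rewrite mevalMn ha.
- by move=> a IHa b IHb /andP[/IHa ha /IHb hb]; rewrite mevalM ha hb.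
- by move=> a IHa m /IHa ha; rewrite rmorphXn /= ha.
Qed.

(** * Quantifier elimination and projections *)

Import ordered_qelim.

Lemma sa_oformula k (phi : ord.formula R) :
  ord.qf_form phi -> ord.rformula phi ->
  is_semialg (fun x : point R k => ord.holds (env x) phi).
Proof.
have pe t : GRing.rterm t -> polyfun (fun x : point R k => GRing.eval (env x) t).
  by move=> rt; exists (term_mpoly k t) => x; rewrite eval_term_mpoly.
elim: phi => //=.
- by case=> _ _; [apply: sa_equiv (saT k)|apply: sa_equiv (sa_not (saT k)) => x; split].
- by move=> a b _ /andP[ra rb]; apply: sa_eq; apply: pe.
- by move=> a b _ /andP[ra rb]; apply: sa_lt; apply: pe.
- by move=> a b _ /andP[ra rb]; apply: sa_le; apply: pe.
- by move=> a IHa b IHb /andP[? ?] /andP[? ?]; apply: sa_and; [apply: IHa|apply: IHb].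
- by move=> a IHa b IHb /andP[? ?] /andP[? ?]; apply: sa_or; [apply: IHa|apply: IHb].
- by move=> a IHa b IHb /andP[? ?] /andP[? ?]; apply: sa_imp; [apply: IHa|apply: IHb].
- by move=> a IHa ? ?; apply: sa_not; apply: IHa.
Qed.

Definition mpoly_term k (p : {mpoly R[k]}) : GRing.term R :=
  foldr (fun m t => GRing.Add (GRing.Mul (GRing.Const p@_m)
     (foldr (fun (i : 'I_k) u => GRing.Mul (GRing.Exp (GRing.Var R i) (m i)) u)
        (GRing.Const 1) (enum 'I_k))) t)
   (GRing.Const 0) (msupp p).

Lemma rterm_mpoly k (p : {mpoly R[k]}) : GRing.rterm (mpoly_term p).
Proof.
rewrite /mpoly_term; elim: (msupp p) => //= m s ->; rewrite andbT.
by elim: (enum _).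
Qed.

Lemma eval_mpoly_term k (p : {mpoly R[k]}) (x : point R k) :
  GRing.eval (env x) (mpoly_term p) = p.@[x].
Proof.
rewrite mevalE /mpoly_term; elim: (msupp p) => [|m s IH] /=; first by rewrite big_nil.
rewrite big_cons IH; congr (_ * _ + _).
rewrite -[RHS]big_enum /=; elim: (enum _) => [|i r IHr] /=; first by rewrite big_nil.
by rewrite big_cons IHr nth_env valK.
Qed.

Fixpoint qf_oformula k (phi : qf_formula R k) : ord.formula R :=
  match phi with
  | QTrue => ord.Bool true
  | QEq0 p => ord.Equal (mpoly_term p) (GRing.Const 0)
  | QGt0 p => ord.Lt (GRing.Const 0) (mpoly_term p)
  | QLt0 p => ord.Lt (mpoly_term p) (GRing.Const 0)
  | QNot a => ord.Not (qf_oformula a)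
  | QAnd a b => ord.And (qf_oformula a) (qf_oformula b)
  | QOr a b => ord.Or (qf_oformula a) (qf_oformula b)
  end.

Lemma qf_oformulaP k (phi : qf_formula R k) (x : point R k) :
  ord.holds (env x) (qf_oformula phi) <-> qf_holds phi x.
Proof.
elim: phi => [|p|p|p|a IHa|a IHa b IHb|a IHa b IHb] /=;
  rewrite ?eval_mpoly_term //; tauto.
Qed.

Lemma rformula_qf k (phi : qf_formula R k) : ord.rformula (qf_oformula phi).
Proof.
elim: phi => //= [p|p|p|a -> b|a -> b] //; by rewrite rterm_mpoly.
Qed.

(** Variable number [k] is the first one beyond [env x], so quantifying over it amounts to appending
    a coordinate. Eliminating this quantifier leaves a quantifier-free formula to be read in the
    same [env x]. *)
Lemma sa_exists_last k (S : point R k.+1 -> Prop) :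
  is_semialg S -> is_semialg (fun x => exists r, S (ext x r)).
Proof.
move=> /saE[phi hphi].
pose psi := ord.Exists k (qf_oformula phi).
have rpsi : ord.rformula psi by rewrite /psi /= rformula_qf.
have /andP[qq rq] :=
  ord.quantifier_elim_wf (@qe_rcf.wf_QE_wproj R) rpsi.
apply: sa_equiv (sa_oformula k qq rq) => x.
have H := ord.quantifier_elim_rformP (@qe_rcf.wf_QE_wproj R)
  (@qe_rcf.valid_QE_wproj R) (env x) rpsi.
have E r : set_nth 0 (env x) k r = env (ext x r).
  have sx : size (env x) = k by rewrite size_map size_enum_ord.
  apply: (@eq_from_nth _ 0) => [|i _].
    by rewrite size_set_nth sx [size (env (ext x r))]size_map size_enum_ord; lia.
  rewrite nth_set_nth /= !nth_env.
  case: eqP => [->|ne].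
    case: insubP => [j _ jk|] /=; last by rewrite leqnn.
    have -> : j = ord_max by apply: val_inj.
    by rewrite ext_max.
  case: insubP => [j _ ji|nl]; case: insubP => [l ll li|nl'] //=.
  - have -> : l = widen_ord (leqnSn k) j by apply: val_inj; rewrite /= li -ji.
    by rewrite ext_widen.
  - by move: nl'; rewrite -ji (ltn_trans (ltn_ord j)).
  - by exfalso; move: ll nl; lia.
have Eq : ord.holds (env x) psi <-> exists r, S (ext x r).
  split=> -[r h]; exists r; move: h => /=; rewrite E.
    by move/(qf_oformulaP phi (ext x r))/hphi.
  by move/hphi => h; apply/(qf_oformulaP phi (ext x r)).
rewrite -Eq; split=> h.
- by apply/H; apply/(ord.qf_evalP _ qq).
- by apply/(ord.qf_evalP _ qq); apply/H.
Qed.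

Lemma sa_exists n (T : point R n -> R -> Prop) :
  is_semialg (fun z : point R n.+1 => T (front z) (z ord_max)) ->
  is_semialg (fun x => exists r, T x r).
Proof.
move=> /sa_exists_last; apply: sa_equiv => x.
by split=> -[r h]; exists r; move: h; rewrite front_ext ext_max.
Qed.

Lemma sa_forall n (T : point R n -> R -> Prop) :
  is_semialg (fun z : point R n.+1 => T (front z) (z ord_max)) ->
  is_semialg (fun x => forall r, T x r).
Proof.
move=> /sa_not hT; apply: (sa_equiv _ (sa_not (sa_exists (T := fun x r => ~ T x r) hT))) => x.
by split=> [h r|h [r nT]]; [apply: NNPP => nT; apply: h; exists r|case: (nT (h r))].
Qed.

(** Induction on [m]: the first coordinate of [y] is moved to the end of [x] and quantified
    separately. The index types then agree up to a cast. *)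
Lemma sa_exists_point m n (T : point R n -> point R m -> Prop) :
  is_semialg (fun z : point R (n + m) =>
                T (fun i => z (lshift m i)) (fun j => z (rshift n j))) ->
  is_semialg (fun x => exists y, T x y).
Proof.
elim: m n T => [|m IHm] n T hT.
  apply: (@sa_equiv _ (fun x => T x (fun i : 'I_0 => 0))) => [x|].
    split=> [h|[y h]]; first by exists (fun=> 0).
    by have <- : y = fun=> 0 by apply: functional_extensionality => -[].
  have h := sa_comp (a := fun x (i : 'I_(n + 0)) => x (cast_ord (addn0 n) i)) hT
    (fun i => polyfun_coord _).
  apply: sa_equiv h => x /=; set u := fun i => _; set v := fun j => _.
  have -> : u = x.
    by apply: functional_extensionality => i; rewrite /u; congr x; apply: val_inj.
  by have -> : v = fun=> 0 by apply: functional_extensionality => -[].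
pose T' (x : point R n) (r : R) := exists y : point R m,
  T x (fun i => oapp y r (unlift ord0 i)).
apply: (@sa_equiv _ (fun x => exists r, T' x r)) => [x|].
  split=> [[r [y h]]|[y h]]; first by exists (fun i => oapp y r (unlift ord0 i)).
  exists (y ord0), (fun i => y (lift ord0 i)).
  suff -> : (fun i => oapp (fun j => y (lift ord0 j)) (y ord0) (unlift ord0 i)) = y
    by [].
  apply: functional_extensionality => i.
  by case: (unliftP ord0 i) => [j ->|->] /=.
apply: sa_exists; apply: IHm.
have h := sa_comp (a := fun x (i : 'I_(n + m.+1)) => x (cast_ord (addnS n m) i)) hT
    (fun i => polyfun_coord _).
apply: sa_equiv h => x /=.
set u := fun i => _; set v := fun i => _; set u' := front _; set v' := fun i => _.
have -> : u = u'.
  by apply: functional_extensionality => i; rewrite /u /u' /front; congr x; apply: val_inj.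
suff -> : v = v' by [].
apply: functional_extensionality => i; rewrite /v /v'.
by case: (unliftP ord0 i) => [j ->|->] /=; congr x; apply: val_inj => /=;
   rewrite /bump /=; lia.
Qed.

End Semialgebraic.

(** * Completeness and compactness *)

(** [P] may be undecidable, whence the classical descent on a bound for [f x]. *)
Lemma ex_min_nat (T : Type) (P : T -> Prop) (f : T -> nat) :
  (exists x, P x) -> exists2 x, P x & forall y, P y -> (f x <= f y)%N.
Proof.
move=> [x0 Px0]; apply: NNPP => nex.
suff H m x : P x -> (f x <= m)%N -> False by exact: (H (f x0) x0).
elim: m x => [|m IHm] x Px fx.
  by apply: nex; exists x => // y _; move: fx; rewrite leqn0 => /eqP->.
apply: nex; exists x => // y Py; rewrite leqNgt; apply/negP => lt_yx.
by apply: (IHm y Py); rewrite -ltnS (leq_trans lt_yx).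
Qed.

Lemma count_lt (T : eqType) (a b : pred T) (s : seq T) x :
  (forall y, y \in s -> a y -> b y) -> x \in s -> b x -> ~~ a x ->
  (count a s < count b s)%N.
Proof.
elim: s => // y s IH sub; rewrite inE => /orP[/eqP->|xs] bx nax /=.
  rewrite bx (negbTE nax) add0n add1n ltnS.
  rewrite -(@eq_in_count _ (predI a b)); last first.
    move=> z zs; rewrite /= andb_idr // => az.
    by apply: sub az; rewrite inE zs orbT.
  by apply: sub_count => z /andP[].
rewrite -addnS leq_add //.
  by case: (boolP (a y)) => // ay; rewrite (sub y) ?mem_head.
by apply: IH => // z zs; apply: sub; rewrite inE zs orbT.
Qed.

Section Completeness.
Variable R : rcfType.

Definition univariate (p : {mpoly R[1]}) : {poly R} :=
  \sum_(m <- msupp p) p@_m *: 'X^(m ord0).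

Lemma horner_univariate p (x : point R 1) : (univariate p).[x ord0] = p.@[x].
Proof.
rewrite mevalE horner_sum; apply: eq_bigr => m _.
by rewrite hornerZ hornerXn big_ord1.
Qed.

Lemma all_roots_seq (p : {poly R}) :
  exists rs : seq R, p != 0 -> forall x, root p x -> x \in rs.
Proof.
exists (roots p (- cauchy_bound p) (cauchy_bound p)) => p0 x px.
by rewrite -root_is_roots // root_in_cauchy_bound.
Qed.

(** The list collects the roots of the nonzero atoms. By the intermediate value theorem every atom
    has constant sign on an interval that avoids them. *)
Lemma breakpoints (phi : qf_formula R 1) : exists rs : seq R,
  forall a b : point R 1, a ord0 <= b ord0 ->
    (forall x, a ord0 <= x <= b ord0 -> x \notin rs) ->
    (qf_holds phi a <-> qf_holds phi b).
Proof.
have atom p : exists rs : seq R,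
    forall a b : point R 1, a ord0 <= b ord0 ->
    (forall x, a ord0 <= x <= b ord0 -> x \notin rs) ->
    Num.sg p.@[a] = Num.sg p.@[b].
  have [rs hrs] := all_roots_seq (univariate p).
  exists rs => a b le_ab nr; rewrite -!horner_univariate.
  have [->|p0] := eqVneq (univariate p) 0; first by rewrite !horner0.
  apply: (@polyrN0_itv R `[a ord0, b ord0]).
  - by move=> x; rewrite in_itv /= => /nr; apply: contra; apply: hrs.
  - by rewrite in_itv /= lexx le_ab.
  - by rewrite in_itv /= lexx le_ab.
elim: phi => [|p|p|p|f [r1 h1]|f [r1 h1] g [r2 h2]|f [r1 h1] g [r2 h2]] /=.
- by exists [::].
- have [rs hrs] := atom p; exists rs => a b ab nr.
  have /(congr1 (eq_op^~ 0)) /= := hrs a b ab nr; rewrite !sgr_eq0 => e.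
  by split=> /eqP h; apply/eqP; move: h; rewrite e.
- have [rs hrs] := atom p; exists rs => a b ab nr.
  by have := hrs a b ab nr => e; rewrite -sgr_gt0 e sgr_gt0.
- have [rs hrs] := atom p; exists rs => a b ab nr.
  by have := hrs a b ab nr => e; rewrite -sgr_lt0 e sgr_lt0.
- by exists r1 => a b ab nr; have := h1 a b ab nr; tauto.
- exists (r1 ++ r2) => a b ab nr.
  have n1 x : a ord0 <= x <= b ord0 -> x \notin r1.
    by move=> /nr; rewrite mem_cat negb_or => /andP[].
  have n2 x : a ord0 <= x <= b ord0 -> x \notin r2.
    by move=> /nr; rewrite mem_cat negb_or => /andP[].
  by have := h1 a b ab n1; have := h2 a b ab n2; tauto.
- exists (r1 ++ r2) => a b ab nr.
  have n1 x : a ord0 <= x <= b ord0 -> x \notin r1.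
    by move=> /nr; rewrite mem_cat negb_or => /andP[].
  have n2 x : a ord0 <= x <= b ord0 -> x \notin r2.
    by move=> /nr; rewrite mem_cat negb_or => /andP[].
  by have := h1 a b ab n1; have := h2 a b ab n2; tauto.
Qed.

Lemma seq_max (s : seq R) (x0 : R) : x0 \in s ->
  exists2 x, x \in s & forall y, y \in s -> y <= x.
Proof.
elim: s x0 => // a [|b s] IH x0 _.
  by exists a; rewrite ?mem_head // => y; rewrite inE => /eqP->.
have [x xs hx] := IH b (mem_head _ _).
have [le_ax|lt_xa] := leP a x.
  exists x => [|y]; rewrite inE ?xs ?orbT // => /orP[/eqP->|/hx] //.
exists a => [|y]; rewrite inE ?eqxx // => /orP[/eqP->|/hx] // yx.
exact: le_trans yx (ltW lt_xa).
Qed.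

Definition unary_sa (S : R -> Prop) :=
  is_semialg (fun z : point R 1 => S (z ord0)).

(** Take [s] in [S] with the fewest breakpoints below or at [s]. The largest of these breakpoints is
    the infimum: a smaller member of [S] would have fewer breakpoints, and no breakpoint separates
    [s] from the points just above it. If there are none, [S] contains points below [l]. *)
Lemma unary_sa_inf (S : R -> Prop) (l : R) : unary_sa S ->
  (exists s, S s) -> (forall s, S s -> l <= s) ->
  exists c, (forall s, S s -> c <= s) /\
            (forall e, 0 < e -> exists2 s, S s & s < c + e).
Proof.
move=> /saE[phi hphi] exS lbS.
have [rs hrs'] := breakpoints phi.
have hrs a b : a <= b -> (forall x, a <= x <= b -> x \notin rs) -> S b -> S a.
  move=> ab nr; have := hrs' (fun=> a) (fun=> b) ab nr.
  by have := hphi (fun=> a); have := hphi (fun=> b); tauto.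
have [s Ss smin] := @ex_min_nat R S (fun s => count (<= s) rs) exS.
have cnt s' r : S s' -> r \in rs -> r <= s -> s' < r -> False.
  move=> Ss' rr rs_ s'r; have := smin s' Ss'.
  rewrite leqNgt => /negP; apply; apply: count_lt rr _ _ => //.
    by move=> x _ /le_trans; apply; exact: le_trans (ltW s'r) rs_.
  by rewrite -ltNge.
have [[r0 r0in r0s]|norts] := @hasP R (<= s) rs.
  have [|r] := @seq_max [seq x <- rs | x <= s] r0; first by rewrite mem_filter r0in andbT.
  rewrite mem_filter => /andP[r_s rin] rmax.
  exists r; split=> [s' Ss'|e e0].
    by rewrite leNgt; apply/negP => s'r; exact: cnt Ss' rin r_s s'r.
  have [le_sr|lt_rs] := leP s r; first by exists s => //; lra.
  exists (Num.min s (r + e / 2)); last first.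
    by rewrite gt_min; apply/orP; right; lra.
  apply: hrs Ss; first by rewrite ge_min lexx.
  move=> x /andP[]; rewrite ge_min => hx xs; apply/negP => xin.
  have := rmax x; rewrite mem_filter xs xin => /(_ isT) xr.
  by move: hx => /orP[]; lra.
exfalso.
have : S (Num.min l s - 1).
  apply: hrs Ss; first by rewrite lerBlDr ge_min; apply/orP; right; lra.
  by move=> x /andP[_ xs]; apply/negP => xin; apply: norts; exists x.
move=> /lbS; have : Num.min l s <= l by rewrite ge_min lexx.
by lra.
Qed.

Lemma unary_sa_sup (S : R -> Prop) (l : R) : unary_sa S ->
  (exists s, S s) -> (forall s, S s -> s <= l) ->
  exists c, (forall s, S s -> s <= c) /\
            (forall e, 0 < e -> exists2 s, S s & c - e < s).
Proof.
move=> hS [s0 Ss0] ub.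
have hN : unary_sa (fun s => S (- s)).
  exact: (sa_comp (a := fun (z : point R 1) i => - z i) hS
            (fun i => polyfunN (polyfun_coord R i))).
have [||c [lbc apx]] := @unary_sa_inf _ (- l) hN.
- by exists (- s0); rewrite opprK.
- by move=> s /ub; lra.
exists (- c); split=> [s Ss|e /apx[s Ss lt]].
  by have := lbc (- s); rewrite opprK => /(_ Ss); lra.
by exists (- s) => //; lra.
Qed.

Lemma polyfun_eq n (F G : point R n -> R) : F =1 G -> polyfun F -> polyfun G.
Proof. by move=> e [p hp]; exists p => x; rewrite -e. Qed.

Lemma polyfun_ext n m (a : point R n -> point R m) (r : point R n -> R) :
  (forall i, polyfun (fun x => a x i)) -> polyfun r ->
  forall i, polyfun (fun x => ext (a x) (r x) i).
Proof.
move=> ha hr; apply: ord_widenP => [i|].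
  by apply: polyfun_eq (ha i) => x; rewrite ext_widen.
by apply: polyfun_eq hr => x; rewrite ext_max.
Qed.

Lemma near_pt_ext n (x y : point R n) r s e :
  near_pt e x y -> `|r - s| < e -> near_pt e (ext x r) (ext y s).
Proof.
by move=> hx hr; apply: ord_widenP => [i|]; rewrite ?ext_widen ?ext_max.
Qed.

(* The adherent point is built one coordinate at a time: its last coordinate is the limit of
   the infima of the last coordinates of the members of the family. *)
Lemma sa_compact k (C : R -> point R k -> Prop) (b : R) :
  is_semialg (fun z : point R k.+1 => C (z ord_max) (front z)) ->
  (forall e, 0 < e -> exists y, C e y) ->
  (forall e y, 0 < e -> C e y -> forall i, `|y i| <= b) ->
  (forall e e' y, 0 < e -> e <= e' -> C e y -> C e' y) ->
  exists y, forall e dl, 0 < e -> 0 < dl -> exists2 y', C e y' & near_pt dl y y'.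
Proof.
elim: k C => [|k IHk] C hC ne bd mono.
  exists (fun=> 0) => e dl /ne[y Cy] _; exists y => //.
  by move=> -[].
(* The supremum [c] of these eventual lower bounds is the lower limit, as [e] tends to [0], of the
   last coordinates of the members of [C e]. *)
pose B s := exists e, 0 < e /\ forall s', (exists y : point R k, C e (ext y s')) -> s <= s'.
have saB : unary_sa B.
  apply: (sa_exists (T := fun (z : point R 1) e => 0 < e /\ forall s',
      (exists y : point R k, C e (ext y s')) -> z ord0 <= s')).
  apply: sa_and.
    by apply: sa_lt; [apply: polyfun_const|apply: polyfun_coord].
  apply: (sa_forall (T := fun (z : point R 2) s' =>
     (exists y : point R k, C (z ord_max) (ext y s')) -> front z ord0 <= s')).
  apply: sa_imp; last by apply: sa_le; apply: polyfun_coord.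
  apply: (sa_exists_point (T := fun (z : point R 3) y =>
      C (front z ord_max) (ext y (z ord_max)))).
  pose a (z : point R (3 + k)) : point R k.+2 :=
    ext (ext (fun j => z (rshift 3 j)) (z (lshift k ord_max)))
        (front (fun i => z (lshift k i)) ord_max).
  apply: sa_equiv (sa_comp (a := a) hC _) => [z|].
    by rewrite /a ext_max front_ext.
  apply: polyfun_ext; last exact: polyfun_coord.
  by apply: polyfun_ext => [i|]; apply: polyfun_coord.
have extC e s : C e (ext (front s) (s ord_max)) <-> C e s by rewrite ext_front.
have [||c [ubc apx]] := @unary_sa_sup _ b saB.
- exists (- b), 1; split=> // s' [y Cy].
  by have := bd 1 _ ltr01 Cy ord_max; rewrite ext_max ler_norml => /andP[].
- move=> s [e [e0 h]]; have [y Cy] := ne e e0.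
  have ys : s <= y ord_max by apply: h; exists (front y); rewrite ext_front.
  have := bd e y e0 Cy ord_max; rewrite ler_norml => /andP[_].
  exact: le_trans.
(* The members whose last coordinate is within [e] of [c] are projected. Since [e] plays both roles,
   the new family still shrinks with [e]. *)
pose C' e y := exists s, [/\ `|s - c| < e & C e (ext y s)].
have near_c e dl : 0 < e -> 0 < dl -> exists y s, `|s - c| < dl /\ C e (ext y s).
  move=> e0 dl0; have dl20 : 0 < dl / 2 by lra.
  have [s1 [e1 [e10 h1]] s1c] := apx _ dl20.
  have e'0 : 0 < Num.min e e1 by rewrite lt_min e0 e10.
  (* No number above [c] is an eventual lower bound, so every [C e] has members with last coordinate
     below [c + dl / 2]; the bound [s1] keeps those with small parameter above [c - dl / 2]. *)
  have nB : ~ B (c + dl / 2) by move=> /ubc; lra.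
  apply: NNPP => nex; apply: nB; exists (Num.min e e1); split=> // s' [y Cy].
  rewrite leNgt; apply/negP => s'c; apply: nex; exists y, s'; split; last first.
    by apply: mono Cy => //; rewrite ge_min lexx.
  have : s1 <= s'.
    by apply: h1; exists y; apply: mono Cy => //; rewrite ge_min lexx orbT.
  by move=> hs; rewrite ltr_norml; apply/andP; split; lra.
have [|||| y hy] := IHk C'.
- apply: (sa_exists (T := fun (z : point R k.+1) s =>
     [/\ `|s - c| < z ord_max & C (z ord_max) (ext (front z) s)])).
  pose a (w : point R k.+2) : point R k.+2 :=
    ext (ext (front (front w)) (w ord_max)) (front w ord_max).
  have pa i : polyfun (fun w => a w i).
    apply: polyfun_ext i; last exact: polyfun_coord.
    by apply: polyfun_ext => [i|]; apply: polyfun_coord.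
  have h1 : is_semialg (fun w : point R k.+2 => w ord_max - c < front w ord_max).
    by apply: sa_lt; rewrite /front; do ?[apply: polyfunD|apply: polyfun_coord|apply: polyfun_const].
  have h2 : is_semialg (fun w : point R k.+2 => c - w ord_max < front w ord_max).
    by apply: sa_lt; rewrite /front; do ?[apply: polyfunD|apply: polyfunN|apply: polyfun_coord|apply: polyfun_const].
  apply: sa_equiv (sa_and (sa_and h1 h2) (sa_comp (a := a) hC pa)) => w.
  rewrite /a ext_max front_ext ltr_norml.
  by split=> [[[? ?] ?]|[/andP[? ?] ?]]; split=> //; [apply/andP|]; split; lra.
- move=> e e0; have [y [s [sc Cy]]] := near_c e e e0 e0.
  by exists y, s.
- move=> e y e0 [s [_ Cy]] i.
  by have := bd e _ e0 Cy (widen_ord (leqnSn k) i); rewrite ext_widen.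
- move=> e e' y e0 ee' [s [sc Cy]]; exists s; split.
    exact: lt_le_trans ee'.
  exact: mono Cy.
exists (ext y c) => e dl e0 dl0.
have m0 : 0 < Num.min e dl by rewrite lt_min e0 dl0.
have [y' [s [sc Cy']] near] := hy _ _ m0 dl0.
exists (ext y' s); first by apply: mono Cy' => //; rewrite ge_min lexx.
apply: near_pt_ext => //; rewrite distrC; apply: lt_le_trans sc _.
by rewrite ge_min lexx orbT.
Qed.

(** * Lipschitz bounds on cubes and attained minima *)

Definition lipschitz n (F : point R n -> R) := forall b, exists2 M, 0 < M &
  forall x y, (forall i, `|x i| <= b) -> (forall i, `|y i| <= b) ->
    `|F x| <= M /\ forall e, 0 <= e -> (forall i, `|x i - y i| <= e) ->
      `|F x - F y| <= M * e.

Lemma lipschitz_const n c : lipschitz (fun _ : point R n => c).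
Proof.
move=> b; exists (`|c| + 1) => [|x y _ _]; first by have := normr_ge0 c; lra.
split=> [|e e0 _]; first lra.
by rewrite subrr normr0 mulr_ge0 // addr_ge0.
Qed.

Lemma lipschitz_coord n (i : 'I_n) : lipschitz (fun x : point R n => x i).
Proof.
move=> b; exists (`|b| + 1) => [|x y hx hy]; first by have := normr_ge0 b; lra.
split=> [|e e0 h]; first by have := hx i; have := ler_norm b; lra.
by have := h i; have := normr_ge0 b; nra.
Qed.

Lemma lipschitzD n (F G : point R n -> R) :
  lipschitz F -> lipschitz G -> lipschitz (fun x => F x + G x).
Proof.
move=> hF hG b; have [M M0 h] := hF b; have [N N0 k] := hG b.
exists (M + N) => [|x y hx hy]; first lra.
have [h1 h2] := h x y hx hy; have [k1 k2] := k x y hx hy.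
split=> [|e e0 d]; first by apply: le_trans (ler_normD _ _) _; lra.
have -> : F x + G x - (F y + G y) = (F x - F y) + (G x - G y) by ring.
apply: le_trans (ler_normD _ _) _; have := h2 e e0 d; have := k2 e e0 d; lra.
Qed.

Lemma lipschitzM n (F G : point R n -> R) :
  lipschitz F -> lipschitz G -> lipschitz (fun x => F x * G x).
Proof.
move=> hF hG b; have [M M0 h] := hF b; have [N N0 k] := hG b.
(* The bounds on both factors enter the product rule, which is why [lipschitz] carries a bound next
   to the Lipschitz estimate. Each half of the splitting below contributes [M * N * e]. *)
exists (2 * (M * N)) => [|x y hx hy]; first by rewrite mulr_gt0 ?mulr_gt0.
have [h1 h2] := h x y hx hy; have [k1 k2] := k x y hx hy.
have [k3 _] := k y x hy hx.
split=> [|e e0 d].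
  rewrite normrM; apply: (@le_trans _ _ (M * N)); first exact: ler_pM.
  by have := mulr_gt0 M0 N0; lra.
have -> : F x * G x - F y * G y = F x * (G x - G y) + (F x - F y) * G y by ring.
apply: le_trans (ler_normD _ _) _; rewrite !normrM.
have a1 : `|F x| * `|G x - G y| <= M * (N * e) by apply: ler_pM => //; exact: k2.
have a2 : `|F x - F y| * `|G y| <= (M * e) * N by apply: ler_pM => //; exact: h2.
lra.
Qed.

(** Induction over the ring operations instead of monomials suits the Lipschitz estimates and the
    Taylor expansion, both stable under sums and products. *)
Lemma mpoly_ring_ind n (P : {mpoly R[n]} -> Prop) :
  (forall c, P c%:MP) -> (forall i, P 'X_i) ->
  (forall p q, P p -> P q -> P (p + q)) -> (forall p q, P p -> P q -> P (p * q)) ->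
  forall p, P p.
Proof.
move=> hC hX hD hM; elim/mpolyind => [|c m p _ _ Pp].
  by have := hC 0; rewrite mpolyC0.
apply: (hD) => //; rewrite -mul_mpolyC; apply: (hM) => //.
rewrite mpolyXE_id; apply: (big_ind P) => [|x y|i _]; [exact: hC 1|exact: hM|].
elim: (m i) => [|j IH]; first by rewrite expr0; exact: hC 1.
by rewrite exprS; apply: hM.
Qed.

Lemma lipschitz_polyfun n (F : point R n -> R) : polyfun F -> lipschitz F.
Proof.
move=> [p hp].
have E (G H : point R n -> R) : G =1 H -> lipschitz G -> lipschitz H.
  move=> e l b; have [M M0 h] := l b; exists M => // x y hx hy.
  by rewrite -!e; exact: h.
apply: (E (fun x => p.@[x])) => [x|]; first by rewrite hp.
elim/mpoly_ring_ind: p {hp} => [c|i|p q lp lq|p q lp lq].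
- by apply: (E _ _ _ (@lipschitz_const n c)) => x; rewrite mevalC.
- by apply: (E _ _ _ (@lipschitz_coord n i)) => x; rewrite mevalXU.
- by apply: (E _ _ _ (lipschitzD lp lq)) => x; rewrite mevalD.
- by apply: (E _ _ _ (lipschitzM lp lq)) => x; rewrite mevalM.
Qed.

Lemma polyfun_bounded n (F : point R n -> R) b : polyfun F ->
  exists2 M, 0 < M & forall x, (forall i, `|x i| <= b) -> `|F x| <= M.
Proof.
move=> /lipschitz_polyfun/(_ b)[M M0 h]; exists M => // x hx.
by have [] := h x x hx hx.
Qed.

Lemma point_bounded n (x : point R n) : exists2 b, 0 < b & forall i, `|x i| <= b.
Proof.
exists (\sum_i `|x i| + 1) => [|i].
  by rewrite ltr_wpDl // sumr_ge0.
by rewrite (bigD1 i) //= -addrA lerDl addr_ge0 // sumr_ge0.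
Qed.

Lemma polyfun_continuous n (F : point R n -> R) (x : point R n) e :
  polyfun F -> 0 < e -> exists2 dl, 0 < dl &
    forall y, near_pt dl x y -> `|F y - F x| < e.
Proof.
move=> hF e0; have [b b0 hb] := point_bounded x.
have [M M0 h] := lipschitz_polyfun hF (b + 1).
have q0 : 0 < e / (2 * M) by apply: divr_gt0 => //; lra.
exists (Num.min 1 (e / (2 * M))) => [|y near]; first by rewrite lt_min ltr01.
have hx i : `|x i| <= b + 1 by have := hb i; lra.
have hy i : `|y i| <= b + 1.
  have := near i; rewrite lt_min distrC => /andP[h1 _].
  have -> : y i = x i + (y i - x i) by ring.
  by apply: le_trans (ler_normD _ _) _; have := hb i; lra.
have [_ h2] := h y x hy hx.
have : `|F y - F x| <= M * (e / (2 * M)).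
  apply: h2 (ltW q0) _ => i; rewrite distrC; apply/ltW.
  by apply: lt_le_trans (near i) _; rewrite ge_min lexx orbT.
have -> : M * (e / (2 * M)) = e / 2 by field; lra.
by move=> /le_lt_trans; apply; lra.
Qed.

(** The set of values is semialgebraic and has an infimum [c]. The parts of [K] where [F] is below
    [c + e] are nonempty and nested; a point adherent to all of them lies in [K] and has value [c]
    by continuity. *)
Lemma polyfun_min_attained k (K : point R k -> Prop) (F : point R k -> R) b :
  is_semialg K -> is_closed K -> (exists y, K y) ->
  (forall y, K y -> forall i, `|y i| <= b) -> polyfun F ->
  exists2 y, K y & forall y', K y' -> F y <= F y'.
Proof.
move=> hK cK [y0 Ky0] bK pF.
pose V s := exists y, K y /\ F y = s.
have saV : unary_sa V.
  apply: (sa_exists_point (T := fun (z : point R 1) y => K y /\ F y = z ord0)).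
  apply: sa_and.
    apply: (sa_comp (a := fun (z : point R (1 + k)) j => z (rshift 1 j)) hK) => i.
    exact: polyfun_coord.
  apply: sa_eq; last exact: polyfun_coord.
  by apply: (polyfun_comp pF) => i; apply: polyfun_coord.
have [M M0 hM] := polyfun_bounded b pF.
have [||c [lbc apx]] := @unary_sa_inf V (- M) saV.
- by exists (F y0), y0.
- by move=> s [y [Ky <-]]; have := hM y (bK y Ky); rewrite ler_norml => /andP[].
pose C e y := K y /\ F y < c + e.
have [|||| y hy] := @sa_compact k C b.
- apply: sa_and.
    by apply: (sa_comp (a := @front R k) hK) => i; apply: polyfun_coord.
  apply: sa_lt; first by apply: (polyfun_comp pF) => i; apply: polyfun_coord.
  by apply: polyfunD; [apply: polyfun_const|apply: polyfun_coord].
- by move=> e /apx[s [y [Ky <-]] lt]; exists y.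
- by move=> e y _ [Ky _]; apply: bK.
- by move=> e e' y _ le [Ky lt]; split=> //; lra.
have Ky : K y.
  by apply: cK => dl dl0; have [y' [Ky' _] near] := hy 1 dl ltr01 dl0; exists y'.
exists y => // y' Ky'; apply: (@le_trans _ _ c); last by apply: lbc; exists y'.
rewrite leNgt; apply/negP => lt.
have e0 : 0 < (F y - c) / 2 by lra.
have [dl dl0 hdl] := polyfun_continuous y pF e0.
have [y'' [_ lt'] near] := hy _ _ e0 dl0.
by have := hdl y'' near; rewrite ltr_norml => /andP[]; lra.
Qed.

End Completeness.

(** * Elimination by counting dimensions *)

Section Span.
Variables (K : fieldType) (X : Type) (D : X -> Prop).

(** Linear combinations with equality tested on [D] only, so that equations valid on [D] serve as
    rewriting rules. The inductive form leaves the number of summands implicit. *)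
Inductive span (E : (X -> K) -> Prop) : (X -> K) -> Prop :=
  | Span0 phi : (forall x, D x -> phi x = 0) -> span E phi
  | SpanD phi a psi chi : span E phi -> E psi ->
      (forall x, D x -> chi x = phi x + a * psi x) -> span E chi.

Lemma span_eq E phi psi :
  (forall x, D x -> phi x = psi x) -> span E phi -> span E psi.
Proof.
move=> e h; case: h e => [f f0|f a g h sf Eg hh] e.
  by apply: Span0 => x Dx; rewrite -e // f0.
by apply: (SpanD (a := a) sf Eg) => x Dx; rewrite -e // hh.
Qed.

Lemma span_base (E : (X -> K) -> Prop) phi : E phi -> span E phi.
Proof.
move=> Ep; apply: (@SpanD E (fun=> 0) 1 phi) => //; first exact: Span0.
by move=> x _; rewrite add0r mul1r.
Qed.

Lemma span_add E phi psi :
  span E phi -> span E psi -> span E (fun x => phi x + psi x).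
Proof.
move=> sp; elim=> [f f0|f a g h sf IH Eg hh].
  by apply: (span_eq _ sp) => x Dx; rewrite f0 // addr0.
by apply: (SpanD (a := a) IH Eg) => x Dx; rewrite hh // addrA.
Qed.

Lemma span_mul (E E' : (X -> K) -> Prop) (m : X -> K) phi :
  (forall psi, E psi -> E' (fun x => m x * psi x)) ->
  span E phi -> span E' (fun x => m x * phi x).
Proof.
move=> hm; elim=> [f f0|f a g h sf IH Eg hh].
  by apply: Span0 => x Dx; rewrite f0 // mulr0.
apply: (SpanD (a := a) IH (hm _ Eg)) => x Dx.
by rewrite hh // mulrDr !mulrA (mulrC (m x) a).
Qed.

Lemma span_scale E a phi : span E phi -> span E (fun x => a * phi x).
Proof.
elim=> [f f0|f b g h sf IH Eg hh].
  by apply: Span0 => x Dx; rewrite f0 // mulr0.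
by apply: (SpanD (a := a * b) IH Eg) => x Dx; rewrite hh // mulrDr mulrA.
Qed.

Lemma span_sum E (I : eqType) (r : seq I) (F : I -> X -> K) :
  (forall i, i \in r -> span E (F i)) -> span E (fun x => \sum_(i <- r) F i x).
Proof.
elim: r => [|i r IH] hF; first by apply: Span0 => x _; rewrite big_nil.
apply: (@span_eq _ (fun x => F i x + \sum_(i <- r) F i x)) => [x _|].
  by rewrite big_cons.
apply: span_add; first by apply: hF; rewrite mem_head.
by apply: IH => j jr; apply: hF; rewrite inE jr orbT.
Qed.

Lemma span_mono (E E' : (X -> K) -> Prop) phi :
  (forall psi, E psi -> E' psi) -> span E phi -> span E' phi.
Proof.
move=> EE'; elim=> [f f0|f a g h sf IH Eg hh]; first exact: Span0.
exact: SpanD IH (EE' _ Eg) hh.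
Qed.

Lemma span_coord (J : finType) (b : J -> X -> K) (E : (X -> K) -> Prop) phi :
  (forall psi, E psi -> exists j, psi =1 b j) -> span E phi ->
  exists w : J -> K, forall x, D x -> phi x = \sum_j w j * b j x.
Proof.
move=> hE; elim=> [f f0|f a g h sf [w hw] Eg hh].
  by exists (fun=> 0) => x Dx; rewrite f0 // big1 // => j _; rewrite mul0r.
have [j0 hj0] := hE _ Eg.
exists (fun j => w j + a * (j == j0)%:R) => x Dx.
rewrite hh // hw // hj0.
under [RHS]eq_bigr do rewrite mulrDl.
rewrite big_split /=; congr (_ + _).
rewrite (bigD1 j0) //= eqxx mulr1 big1 ?addr0 // => j /negbTE->.
by rewrite mulr0 mul0r.
Qed.

(** A matrix with more rows than columns has a nonzero left kernel. *)
Lemma linear_dependency (I J : finType) (M : I -> J -> K) : (#|J| < #|I|)%N ->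
  exists c : I -> K, (exists i, c i != 0) /\ forall j, \sum_i c i * M i j = 0.
Proof.
move=> ltJI; pose A : 'M[K]_(#|I|, #|J|) := \matrix_(i, j) M (enum_val i) (enum_val j).
have : kermx A != 0.
  rewrite -mxrank_eq0 mxrank_ker -lt0n subn_gt0.
  exact: leq_ltn_trans (rank_leq_col A) ltJI.
move=> /matrix0Pn[i [j kij]].
exists (fun x => kermx A i (enum_rank x)); split.
  by exists (enum_val j); rewrite enum_valK.
move=> l; have := mulmx_ker A => /matrixP/(_ i (enum_rank l)).
rewrite mxE [RHS]mxE => h; rewrite -[RHS]h (reindex (fun x : 'I_#|I| => enum_val x)) /=; last first.
  by exists enum_rank => x _; rewrite ?enum_valK ?enum_rankK.
by apply: eq_bigr => x _; rewrite enum_valK [A _ _]mxE enum_rankK.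
Qed.

(** In coordinates with respect to [b], a relation between the [phi i] becomes [#|J|] linear
    equations in [#|I|] unknowns. *)
Lemma span_dependency (I J : finType) (b : J -> X -> K) (E : (X -> K) -> Prop)
  (phi : I -> X -> K) :
  (forall psi, E psi -> exists j, psi =1 b j) ->
  (forall i, span E (phi i)) -> (#|J| < #|I|)%N ->
  exists c : I -> K, (exists i, c i != 0) /\
    forall x, D x -> \sum_i c i * phi i x = 0.
Proof.
move=> hE hphi ltJI.
have [M hM] : exists M : I -> J -> K,
    forall i x, D x -> phi i x = \sum_j M i j * b j x.
  have H (s : seq I) : exists M : I -> J -> K,
    forall i, i \in s -> forall x, D x -> phi i x = \sum_j M i j * b j x.
    elim: s => [|i0 s [M hM]]; first by exists (fun _ _ => 0).
    have [w hw] := span_coord hE (hphi i0).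
    exists (fun i => if i == i0 then w else M i) => i; rewrite inE.
    by case: eqP => [->|_] //= /hM.
  by have [M hM] := H (enum I); exists M => i; apply: hM; rewrite mem_enum.
have [c [cn0 hc]] := linear_dependency M ltJI.
exists c; split=> // x Dx.
under eq_bigr do rewrite hM // mulr_sumr.
rewrite exchange_big big1 //= => j _.
under eq_bigr do rewrite mulrA.
by rewrite -mulr_suml hc mul0r.
Qed.

End Span.

(** On the left stands the number of spanning monomials, on the right the number of unknowns. The
    extra power of [u], [B.+1] against [B], outweighs the larger ranges of exponents on the left:
    divided by [e], the difference is [4 B^5 - 2 B^4 - B^3]. *)
Lemma coefficient_count (e B : nat) : (1 < e)%N -> (0 < B)%N ->
  (B * ((e * B + 2 * e * B ^ 2) * (B + 4 * B ^ 3)) <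
   B.+1 * (2 * e * B ^ 2 * (4 * B ^ 3)))%N.
Proof.
move=> e_gt1 B0.
rewrite (_ : B * ((e * B + 2 * e * B ^ 2) * (B + 4 * B ^ 3)) =
   e * (8 * B^6 + 4 * B^5 + 2 * B^4 + B^3))%N; last by ring.
rewrite (_ : B.+1 * (2 * e * B ^ 2 * (4 * B ^ 3)) = e * (8 * B^6 + 8 * B^5))%N;
  last by ring.
rewrite ltn_pmul2l; last lia.
have B45 : (B ^ 4 <= B ^ 5)%N by rewrite leq_pexp2l.
have B35 : (B ^ 3 <= B ^ 5)%N by rewrite leq_pexp2l.
have : (0 < B ^ 5)%N by rewrite expn_gt0 B0.
lia.
Qed.

Section Elimination.
Variables (R : rcfType) (k e : nat).
Variables (G : 'I_k -> {mpoly R[k.+1]}) (cu : 'I_k -> R) (iu : 'I_k).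
Hypothesis e_gt1 : (1 < e)%N.
Hypothesis G_deg : forall i, (msize (G i) <= e.-1)%N.

Let w (i : 'I_k) : 'I_k.+1 := widen_ord (leqnSn k) i.
Let X : Type := (R * point R k.+1)%type.

(** These are the critical equations solved for their leading terms, with [s.1] for [zeta], the last
    coordinate of [s.2] for [t] and coordinate [iu] for [u]. The polynomial [G i] has degree at most
    [e - 2], and the linear term in [u] carries a factor [zeta]. *)
Definition perturbed (s : X) := forall i : 'I_k,
  s.1 ^+ 2 * s.2 (w i) ^+ e = (G i).@[s.2] + cu i * (s.1 * s.2 (w iu)).

Let mon (a : 'I_k -> nat) (z : point R k.+1) := \prod_i z (w i) ^+ a i.

Let bas (b : {ffun 'I_k -> 'I_e}) (j l : nat) (s : X) :=
  mon (fun i => b i) s.2 * s.2 ord_max ^+ j * s.1 ^+ l.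

Let E (bt bz : nat) (psi : X -> R) :=
  exists b j l, [/\ (j <= bt)%N, (l <= bz)%N & psi =1 bas b j l].

Let E_mono bt bz bt' bz' phi : (bt <= bt')%N -> (bz <= bz')%N ->
  span perturbed (E bt bz) phi -> span perturbed (E bt' bz') phi.
Proof.
move=> h1 h2; apply: span_mono => psi [b [j [l [hj hl ep]]]].
by exists b, j, l; split=> //; [exact: leq_trans h1|exact: leq_trans h2].
Qed.

Let E_mul bt bz j l phi : span perturbed (E bt bz) phi ->
  span perturbed (E (bt + j) (bz + l))
    (fun s => (s.2 ord_max ^+ j * s.1 ^+ l) * phi s).
Proof.
apply: span_mul => psi [b [j' [l' [hj hl ep]]]].
exists b, (j' + j)%N, (l' + l)%N; split; rewrite ?leq_add2r //.
by move=> s; rewrite ep /bas !exprD; ring.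
Qed.

Let mon_split (a : 'I_k -> nat) i z : (e <= a i)%N ->
  mon a z = z (w i) ^+ e * mon (fun j => a j - (if j == i then e else 0))%N z.
Proof.
move=> ei; rewrite /mon (bigD1 i) //= [in RHS](bigD1 i) //= eqxx mulrA -exprD subnKC //.
congr (_ * _); apply: eq_bigr => j /negbTE->; by rewrite subn0.
Qed.

Let monD a a' z : mon a z * mon a' z = mon (fun i => a i + a' i)%N z.
Proof. by rewrite /mon -big_split /=; apply: eq_bigr => i _; rewrite exprD. Qed.

Let meval_split (m : 'X_{1..k.+1}) z :
  \prod_i z i ^+ m i = mon (fun i => m (w i)) z * z ord_max ^+ m ord_max.
Proof. by rewrite big_ord_recr. Qed.

(** While some exponent is at least [e], an equation is applied. A monomial of [G i] uses up two
    powers of [zeta] and lowers the total degree by at least two; the term [zeta * u] uses up one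
    power and lowers the degree by [e - 1], hence by at least one. The power of [zeta] therefore
    always suffices. Each use of [G i] adds at most [e - 2] to the degree in [t]. *)
Let monomial_reduction N (a : 'I_k -> nat) : (\sum_i a i <= N)%N ->
  span perturbed (E (e * N) N) (fun s => s.1 ^+ N * mon a s.2).
Proof.
elim: N {-2}N (leqnn N) a => [|N0 IH] N leN a leaN.
  apply: span_base.
  have a0 i : a i = 0%N.
    by apply/eqP; rewrite -leqn0; move: leaN; rewrite (bigD1 i) //=; lia.
  exists [ffun=> Ordinal (ltnW e_gt1)], 0%N, N; split=> // s.
  rewrite /bas expr0 mulr1 mulrC; congr (_ * _).
  by apply: eq_bigr => i _; rewrite ffunE a0.
have [/forallP ha|] := boolP [forall i, a i < e]%N.
  apply: span_base; exists [ffun i => Ordinal (ha i)], 0%N, N; split=> // s.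
  rewrite /bas expr0 mulr1 mulrC; congr (_ * _).
  by apply: eq_bigr => i _; rewrite ffunE.
rewrite negb_forall => /existsP[i]; rewrite -leqNgt => ei.
pose a' j := (a j - (if j == i then e else 0))%N.
have sa' : (\sum_j a j = e + \sum_j a' j)%N.
  rewrite (bigD1 i) //= [in RHS](bigD1 i) //= /a' eqxx addnA subnKC //.
  by congr (_ + _)%N; apply: eq_bigr => j /negbTE->; rewrite subn0.
have hN : (1 < N)%N by lia.
pose T1 (m : 'X_{1..k.+1}) (s : X) := (G i)@_m *
  ((s.2 ord_max ^+ m ord_max * s.1 ^+ 0) *
   (s.1 ^+ N.-2 * mon (fun j => a' j + m (w j))%N s.2)).
pose T2 (s : X) := cu i * (s.1 ^+ N.-1 * mon (fun j => a' j + (j == iu))%N s.2).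
apply: (@span_eq _ _ _ _ (fun s => \sum_(m <- msupp (G i)) T1 m s + T2 s)).
  move=> s Ds.
  have -> : s.1 ^+ N * mon a s.2 =
     s.1 ^+ N.-2 * mon a' s.2 * (s.1 ^+ 2 * s.2 (w i) ^+ e).
    rewrite (mon_split _ ei) -/a' (_ : s.1 ^+ N = s.1 ^+ N.-2 * s.1 ^+ 2); first ring.
    by rewrite -exprD; congr (_ ^+ _); lia.
  rewrite Ds mulrDr; congr (_ + _).
    rewrite mevalE mulr_sumr; apply: eq_bigr => m _.
    rewrite /T1 meval_split -monD expr0; ring.
  rewrite /T2 -monD.
  have -> : mon (fun j => nat_of_bool (j == iu)) s.2 = s.2 (w iu).
    rewrite /mon (bigD1 iu) //= eqxx expr1 big1 ?mulr1 // => j /negbTE->.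
    by rewrite expr0.
  have -> : s.1 ^+ N.-1 = s.1 ^+ N.-2 * s.1.
    by rewrite -exprSr; congr (_ ^+ _); lia.
  ring.
apply: span_add.
  apply: span_sum => m mG; apply: span_scale.
  (* As [msize] is the degree plus one, this says that [m] has degree at most [e - 2]. *)
  have dm := leq_trans (msize_mdeg_lt mG) (G_deg i).
  have md : mdeg m = (\sum_i m (w i) + m ord_max)%N.
    by rewrite mdegE big_ord_recr.
  apply: (@E_mono (e * N.-2 + m ord_max) (N.-2 + 0)).
  - by rewrite -[in X in (_ <= _ * X)%N](subnK hN) mulnDr subn2; lia.
  - lia.
  apply: E_mul; apply: IH; first lia.
  rewrite big_split /=; move: leaN dm; rewrite sa' md.
  by set s1 := (\sum_i a' i)%N; set s2 := (\sum_i m (w i))%N; lia.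
apply: span_scale; apply: (@E_mono (e * N.-1) N.-1); [by rewrite leq_mul2l; lia|lia|].
apply: IH; first lia.
rewrite big_split /= [X in (_ + X <= _)%N](bigD1 iu) //= eqxx.
rewrite [X in (_ + (_ + X) <= _)%N]big1 ?addn0; last by move=> j /negbTE->.
by move: leaN; rewrite sa'; set s1 := (\sum_i a' i)%N; lia.
Qed.

(* [tau] and [sig] are large enough for the unknown coefficients to outnumber the equations. *)
Lemma perturbed_relation (B := (e ^ k)%N) (tau := (2 * e * B ^ 2)%N)
  (sig := (4 * B ^ 3)%N) :
  exists c : 'I_B.+1 * ('I_tau * 'I_sig) -> R, (exists i, c i != 0) /\
  forall s, perturbed s ->
    \sum_i c i * (s.1 ^+ (i.1 + i.2.2) * s.2 (w iu) ^+ i.1 * s.2 ord_max ^+ i.2.1)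
      = 0.
Proof.
have B0 : (0 < B)%N by rewrite expn_gt0; lia.
pose J : finType := ({ffun 'I_k -> 'I_e} * ('I_(e * B + tau) * 'I_(B + sig)))%type.
pose b (j : J) := bas j.1 j.2.1 j.2.2.
apply: (@span_dependency R X perturbed _ J b
          (E (e * B + tau).-1 (B + sig).-1)).
- move=> psi [bb [j [l [hj hl ep]]]].
  have hj' : (j < e * B + tau)%N by move: hj; nia.
  have hl' : (l < B + sig)%N by move: hl; nia.
  by exists (bb, (Ordinal hj', Ordinal hl')) => s; rewrite ep.
- move=> [a [t c]] /=.
  have ha : (a <= B)%N by rewrite -ltnS.
  (* The factor [zeta ^ a * u ^ a] has as many powers of [zeta] as its degree in [u], as
     [monomial_reduction] requires; the remaining factor only shifts the exponents of [t] and
     [zeta]. *)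
  apply: (@span_eq _ _ _ _ (fun s => (s.2 ord_max ^+ t * s.1 ^+ c) *
     (s.1 ^+ a * mon (fun j => a * (j == iu))%N s.2))).
    move=> s _; rewrite exprD.
    have -> : mon (fun j => a * (j == iu))%N s.2 = s.2 (w iu) ^+ a.
      rewrite /mon (bigD1 iu) //= eqxx muln1 big1 ?mulr1 // => j /negbTE->.
      by rewrite muln0 expr0.
    ring.
  apply: (@E_mono (e * a + t) (a + c)).
  - have := ltn_ord t; have : (e * a <= e * B)%N by rewrite leq_mul2l ha orbT.
    lia.
  - by have := ltn_ord c; lia.
  apply: E_mul; apply: monomial_reduction.
  rewrite (bigD1 iu) //= eqxx muln1 big1 ?addn0 // => j /negbTE->.
  by rewrite muln0.
- rewrite /J !card_prod card_ffun !card_ord -/B /tau /sig.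
  exact: coefficient_count.
Qed.

(* [q] is the part of [perturbed_relation] of lowest order in [zeta]. *)
Lemma limit_relation (B := (e ^ k)%N) (tau := (2 * e * B ^ 2)%N) :
  exists q : 'I_B.+1 -> 'I_tau -> R, (exists a b, q a b != 0) /\
  forall t m, (forall eps, 0 < eps -> exists zeta z,
      [/\ 0 < zeta < eps, perturbed (zeta, z), z ord_max = t
        & `|m - z (w iu)| < eps]) ->
    \sum_a (\sum_b q a b * t ^+ b) * m ^+ a = 0.
Proof.
have [c [[i0 ci0] hc]] := perturbed_relation.
rewrite -/B -/tau in c i0 ci0 hc *; set sig := (4 * B ^ 3)%N in c i0 ci0 hc.
pose I : finType := ('I_B.+1 * ('I_tau * 'I_sig))%type.
have [i1 ci1 i1min] := @ex_min_nat I (fun i => c i != 0)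
  (fun i => (i.1 + i.2.2)%N) (ex_intro _ i0 ci0).
set j0 := (i1.1 + i1.2.2)%N in i1min.
pose q (a : 'I_B.+1) (b : 'I_tau) : R :=
  \sum_(l : 'I_sig | (a + l == j0)%N) c (a, (b, l)).
exists q; split.
  (* For a given [a] a single [l] satisfies [a + l = j0], so no cancellation occurs in [q]. *)
  exists i1.1, i1.2.1; rewrite /q (big_pred1 i1.2.2) => [|l].
    by move: ci1; case: (i1) => [? [? ?]].
  by rewrite /j0 eqn_add2l.
move=> t m happ.
pose i3 j : 'I_3 := inord j.
(* [Phi] is the relation divided by [zeta ^ j0], as a polynomial in [zeta], [u], [t]. Terms of order
   below [j0] have zero coefficients, and at [zeta = 0] only those of order [j0] survive. *)
pose Phi (x : point R 3) := \sum_(i : I | (j0 <= i.1 + i.2.2)%N)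
  c i * (x (i3 0) ^+ (i.1 + i.2.2 - j0) * x (i3 1) ^+ i.1 * x (i3 2) ^+ i.2.1).
have pPhi : polyfun Phi.
  pose F (x : point R 3) := \sum_(i <- [seq i : I <- index_enum I | (j0 <= i.1 + i.2.2)%N])
     c i * (x (i3 0%N) ^+ (i.1 + i.2.2 - j0) * x (i3 1%N) ^+ i.1 * x (i3 2%N) ^+ i.2.1).
  have eF : F =1 Phi by move=> x; rewrite /F big_filter.
  apply: polyfun_eq eF _.
  apply: polyfun_sum => i; apply: polyfunM; first exact: polyfun_const.
  by do ?apply: polyfunM; apply: polyfunX; apply: polyfun_coord.
pose pt (a b d : R) : point R 3 := fun i => nth 0 [:: a; b; d] i.
have PhiE a b d : Phi (pt a b d) = \sum_(i : I | (j0 <= i.1 + i.2.2)%N)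
  c i * (a ^+ (i.1 + i.2.2 - j0) * b ^+ i.1 * d ^+ i.2.1).
  by apply: eq_bigr => i _; rewrite /pt /i3 !inordK.
have Phi0 zeta z : zeta != 0 -> perturbed (zeta, z) ->
    Phi (pt zeta (z (w iu)) (z ord_max)) = 0.
  move=> z0 Dz; have := hc _ Dz => /=.
  rewrite (bigID (fun i : I => j0 <= i.1 + i.2.2)%N) /= [X in _ + X]big1 ?addr0.
    have -> : \sum_(i : I | (j0 <= i.1 + i.2.2)%N) c i * (zeta ^+ (i.1 + i.2.2) *
      z (w iu) ^+ i.1 * z ord_max ^+ i.2.1) =
      zeta ^+ j0 * Phi (pt zeta (z (w iu)) (z ord_max)).
      rewrite PhiE mulr_sumr; apply: eq_bigr => i hi.
      rewrite (_ : zeta ^+ (i.1 + i.2.2) = zeta ^+ j0 * zeta ^+ (i.1 + i.2.2 - j0)).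
        ring.
      by rewrite -exprD subnKC.
    by move/eqP; rewrite mulf_eq0 expf_eq0 (negbTE z0) andbF /= => /eqP.
  move=> i; rewrite -ltnNge => hi.
  have [->|ci] := eqVneq (c i) 0; first by rewrite mul0r.
  by have := i1min i ci; rewrite leqNgt hi.
have -> : \sum_a (\sum_b q a b * t ^+ b) * m ^+ a = Phi (pt 0 m t).
  rewrite PhiE.
  transitivity (\sum_(a : 'I_B.+1) \sum_(b : 'I_tau) \sum_(l : 'I_sig)
     (if (j0 <= a + l)%N then
       c (a, (b, l)) * (0 ^+ (a + l - j0) * m ^+ a * t ^+ b) else 0)).
    apply: eq_bigr => a _; rewrite mulr_suml; apply: eq_bigr => b _.
    rewrite /q !mulr_suml big_mkcond /=; apply: eq_bigr => l _.
    case: eqP => [el|nel].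
      by rewrite el leqnn subnn expr0; ring.
    case: leqP => // lej.
    by rewrite expr0n (_ : (a + l - j0 == 0)%N = false) ?mul0r ?mulr0 //; lia.
  under eq_bigr do rewrite pair_big /=.
  rewrite pair_big /= [RHS]big_mkcond /=.
  by apply: eq_bigr => -[a [b l]].
(* [Phi] vanishes at points arbitrarily close to [(0, m, t)], hence there by continuity. *)
apply/eqP; apply: contraT => Pn0.
have P0 : 0 < `|Phi (pt 0 m t)| by rewrite normr_gt0.
have [dl dl0 hdl] := polyfun_continuous (pt 0 m t) pPhi P0.
have [zeta [z [/andP[z0 zdl] Dz zt um]]] := happ dl dl0.
have := hdl (pt zeta (z (w iu)) (z ord_max)) _.
rewrite Phi0 ?lt0r_neq0 // sub0r normrN ltxx; apply=> i.
case: i => -[|[|[|//]]] hi; rewrite /pt /=.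
- by rewrite sub0r normrN gtr0_norm.
- by [].
- by rewrite zt subrr normr0.
Qed.

End Elimination.

(** * Lower bounds for small roots *)

Section LowestTerm.
Variable R : rcfType.

Lemma lowest_term N (c : 'I_N -> R) (x : R) (i0 : 'I_N) :
  (forall i : 'I_N, (i < i0)%N -> c i = 0) -> `|x| <= 1 ->
  `|\sum_i c i * x ^+ i - c i0 * x ^+ i0| <= `|x| ^+ i0.+1 * \sum_i `|c i|.
Proof.
move=> c0 x1; rewrite (bigD1 i0) //= addrAC subrr add0r.
apply: le_trans (ler_norm_sum _ _ _) _.
rewrite mulr_sumr [leRHS](bigD1 i0) //=.
apply: ler_wpDl; first by rewrite mulr_ge0 ?exprn_ge0.
apply: ler_sum => i ne; rewrite normrM normrX mulrC.
have [lt|gt|/val_inj ei] := ltngtP i i0.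
- by rewrite c0 // normr0 !mulr0.
- by apply: ler_wpM2r => //; apply: ler_wiXn2l.
- by rewrite ei eqxx in ne.
Qed.

(** Let [a0] be the least power of [m] with nonzero coefficient [r], a polynomial in [t] with lowest
    term [q0 * t ^ b0]. Dividing by [m ^ a0] gives [|r| <= |m| * S], while
    [|r| >= |q0| / 2 * |t| ^ b0] for small [t]. *)
Lemma root_lower_bound A B (q : 'I_A -> 'I_B -> R) : (exists a b, q a b != 0) ->
  exists2 c, 0 < c & exists2 t0, 0 < t0 & forall t m,
    0 < `|t| < t0 -> m != 0 -> `|m| <= 1 ->
    \sum_a (\sum_b q a b * t ^+ b) * m ^+ a = 0 -> c * `|t| ^+ B <= `|m|.
Proof.
move=> exq.
have [a0 exa a0min] := @ex_min_nat 'I_A (fun a => exists b, q a b != 0)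
  (@nat_of_ord A) exq.
have [b0 qn0 b0min] := @ex_min_nat 'I_B (fun b => q a0 b != 0) (@nat_of_ord B) exa.
set q0 := q a0 b0 in qn0.
have nq0 : 0 < `|q0| by rewrite normr_gt0.
pose S := \sum_a \sum_b `|q a b|.
have S0 : 0 <= \sum_b `|q a0 b| by apply: sumr_ge0.
have leS : \sum_b `|q a0 b| <= S.
  by rewrite /S [leRHS](bigD1 a0) //= lerDl; do 2!apply: sumr_ge0 => ? _.
have q0S : `|q0| <= \sum_b `|q a0 b|.
  by rewrite (bigD1 b0) //= lerDl; apply: sumr_ge0.
have Sp : 0 < S by lra.
exists (`|q0| / (2 * S)); first by apply: divr_gt0 => //; lra.
exists (Num.min 1 (`|q0| / (2 * S))).
  by rewrite lt_min ltr01 divr_gt0 //; lra.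
move=> t m /andP[t0]; rewrite lt_min => /andP[t1 tq] m0 m1 sum0.
have tS : `|t| * S <= `|q0| / 2.
  have -> : `|q0| / 2 = (`|q0| / (2 * S)) * S by field; lra.
  by apply: ler_wpM2r; lra.
have qa0 (b : 'I_B) : (b < b0)%N -> q a0 b = 0.
  move=> lt; apply/eqP; apply: contraT => h.
  by have := b0min b h; rewrite leqNgt lt.
have qaa (a : 'I_A) : (a < a0)%N -> \sum_b q a b * t ^+ b = 0.
  move=> lt; rewrite big1 // => b _.
  have [->|h] := eqVneq (q a b) 0; first by rewrite mul0r.
  by have := a0min a (ex_intro _ b h); rewrite leqNgt lt.
have := lowest_term qaa m1; rewrite sum0 sub0r normrN normrM normrX exprSr -mulrA.
set r := \sum_b q a0 b * t ^+ b.
rewrite [leLHS]mulrC ler_pM2l; last by rewrite exprn_gt0 // normr_gt0.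
move=> hm.
have hS : \sum_a `|\sum_b q a b * t ^+ b| <= S.
  apply: ler_sum => a _; apply: le_trans (ler_norm_sum _ _ _) _.
  apply: ler_sum => b _; rewrite normrM normrX ler_piMr // exprn_ile1 //; lra.
have hr : `|q0| / 2 * `|t| ^+ b0 <= `|r|.
  have t1' : `|t| <= 1 by lra.
  have := lowest_term qa0 t1'; rewrite -/r -/q0 => h.
  have h2 : `|t| ^+ b0.+1 * \sum_b `|q a0 b| <= `|t| ^+ b0 * (`|q0| / 2).
    rewrite exprSr -mulrA; apply: ler_wpM2l; first exact: exprn_ge0.
    by apply: le_trans tS; apply: ler_wpM2l.
  have : `|q0 * t ^+ b0| <= `|r| + `|t| ^+ b0 * (`|q0| / 2).
    have -> : q0 * t ^+ b0 = r - (r - q0 * t ^+ b0) by ring.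
    apply: le_trans (ler_normB _ _) _; lra.
  rewrite normrM normrX; lra.
have htB : `|t| ^+ B <= `|t| ^+ b0.
  by apply: ler_wiXn2l => //; [lra|apply: ltnW].
have h1 : `|q0| / 2 * `|t| ^+ B <= `|m| * S.
  apply: (@le_trans _ _ (`|q0| / 2 * `|t| ^+ b0)); first by apply: ler_wpM2l => //; lra.
  apply: le_trans hr _; apply: le_trans hm _.
  by apply: ler_wpM2l.
have -> : `|q0| / (2 * S) * `|t| ^+ B = (`|q0| / 2 * `|t| ^+ B) / S by field; lra.
by rewrite ler_pdivrMr.
Qed.

End LowestTerm.

(** * First-order conditions and neighbourhoods *)

Section Fermat.
Variable R : rcfType.

Lemma meval_mderiv_XU n (i j : 'I_n) (z : point R n) :
  (mderiv i 'X_j).@[z] = (j == i)%:R.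
Proof.
rewrite mderivX mevalZ mnm1E; case: eqP => [->|_]; last by rewrite mul0r.
have -> : (U_(i) - U_(i))%MM = 0%MM :> 'X_{1..n}.
  by apply/mnmP => l; rewrite mnmBE subnn mnm0E.
by rewrite mpolyX0 meval1 mulr1.
Qed.

Definition shift_coord n (z : point R n) (i : 'I_n) (s : R) : point R n :=
  fun j => if j == i then z j + s else z j.

(** The remainder is a polynomial in [s], so that the difference quotient is continuous at [0]. *)
Lemma taylor1 n (p : {mpoly R[n]}) (i : 'I_n) (z : point R n) :
  exists r : {poly R}, forall s,
    p.@[shift_coord z i s] = p.@[z] + s * ((mderiv i p).@[z] + s * r.[s]).
Proof.
elim/mpoly_ring_ind: p => [c|j|p q [r hr] [r' hr']|p q [r hr] [r' hr']].
- by exists 0 => s; rewrite mderivC meval0 !mevalC horner0; ring.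
- exists 0 => s; rewrite meval_mderiv_XU !mevalXU horner0 /shift_coord.
  by case: eqP => _; rewrite mulr0 addr0 ?mulr1 ?mulr0 ?addr0.
- exists (r + r') => s; rewrite mderivD !mevalD hr hr' hornerD; ring.
- exists ((mderiv i p).@[z]%:P * (mderiv i q).@[z]%:P + p.@[z]%:P * r' + q.@[z]%:P * r
    + 'X * ((mderiv i p).@[z]%:P * r' + (mderiv i q).@[z]%:P * r) + 'X ^+ 2 * r * r') => s.
  rewrite mderivM mevalD !mevalM hr hr' !(hornerE, hornerXn); ring.
Qed.

Lemma mderiv_local_min n (p : {mpoly R[n]}) (i : 'I_n) (z : point R n) dl :
  0 < dl -> (forall s, `|s| < dl -> p.@[z] <= p.@[shift_coord z i s]) ->
  (mderiv i p).@[z] = 0.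
Proof.
move=> dl0 hmin; have [r hr] := taylor1 p i z.
set D := (mderiv i p).@[z] in hr *; apply/eqP; apply: contraT => Dn0.
have nD : 0 < `|D| by rewrite normr_gt0.
have [dl' dl'0 hq] := poly_cont 0 (D%:P + 'X * r) nD.
(* A step against the sign of the derivative, so short that the difference quotient keeps that sign,
   lowers the value. *)
pose s := - Num.sg D * (Num.min dl dl' / 2).
have m0 : 0 < Num.min dl dl' by rewrite lt_min dl0 dl'0.
have ns : `|s| = Num.min dl dl' / 2.
  by rewrite normrM normrN normr_sg Dn0 mul1r gtr0_norm //; lra.
have ms : Num.min dl dl' / 2 < Num.min dl dl' by lra.
have sdl : `|s| < dl by rewrite ns; apply: lt_le_trans ms _; rewrite ge_min lexx.
have sdl' : `|s| < dl' by rewrite ns; apply: lt_le_trans ms _; rewrite ge_min lexx orbT.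
have := hq s; rewrite subr0 => /(_ sdl').
rewrite !(hornerE) => hD.
have := hmin s sdl; rewrite hr lerDl.
set q := D + s * r.[s] in hD *.
rewrite leNgt => /negP[].
have : 0 < Num.sg D * q.
  have [D0|D0|D0] := ltgtP D 0.
  - by rewrite ltr0_sg //; move: hD; rewrite (ltr0_norm D0) ltr_norml => /andP[]; lra.
  - by rewrite gtr0_sg //; move: hD; rewrite (gtr0_norm D0) ltr_norml => /andP[]; lra.
  - by rewrite D0 eqxx in Dn0.
move=> sq; rewrite /s -mulrA mulNr oppr_lt0.
have -> : Num.sg D * (Num.min dl dl' / 2 * q) = Num.min dl dl' / 2 * (Num.sg D * q) by ring.
by apply: mulr_gt0 => //; lra.
Qed.

End Fermat.

Section Neighbourhoods.
Variable R : rcfType.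

Lemma pos_uniform (T : eqType) (r : seq T) (Q : T -> R -> Prop) :
  (forall p c c', 0 < c' <= c -> Q p c -> Q p c') ->
  (forall p, p \in r -> exists2 c, 0 < c & Q p c) ->
  exists2 c, 0 < c & forall p, p \in r -> Q p c.
Proof.
move=> mono; elim: r => [|p r IH] hr; first by exists 1.
have [|c c0 hc] := IH; first by move=> q qr; apply: hr; rewrite inE qr orbT.
have [c' c'0 hc'] := hr p (mem_head _ _).
have m0 : 0 < Num.min c c' by rewrite lt_min c0 c'0.
exists (Num.min c c') => // q; rewrite inE => /orP[/eqP->|/hc].
  by apply: mono hc'; rewrite m0 ge_min lexx orbT.
by apply: mono; rewrite m0 ge_min lexx.
Qed.

Definition nbhd n (y : point R n) (Q : point R n -> Prop) :=
  exists2 dl, 0 < dl & forall y', near_pt dl y y' -> Q y'.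

Lemma near_pt_le n (dl dl' : R) (x y : point R n) :
  dl <= dl' -> near_pt dl x y -> near_pt dl' x y.
Proof. by move=> le near i; apply: lt_le_trans (near i) le. Qed.

Lemma nbhd_all_seq n (T : eqType) (r : seq T) (y : point R n) Q :
  (forall p, p \in r -> nbhd y (Q p)) -> nbhd y (fun y' => forall p, p \in r -> Q p y').
Proof.
move=> h.
have [||c c0 hc] := @pos_uniform T r (fun p c => forall y', near_pt c y y' -> Q p y').
- by move=> p c c' /andP[_ le] hp y' near; apply: hp; apply: near_pt_le near.
- by move=> p /h[dl dl0 hp]; exists dl.
by exists c => // y' near p pr; apply: hc.
Qed.

Lemma nbhd_all n (T : finType) (y : point R n) (Q : T -> point R n -> Prop) :
  (forall p, nbhd y (Q p)) -> nbhd y (fun y' => forall p, Q p y').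
Proof.
move=> h; have [|c c0 hc] := @nbhd_all_seq n T (enum T) y Q; first by move=> p _.
by exists c => // y' near p; apply: hc; rewrite ?mem_enum.
Qed.

Lemma nbhd_and n (y : point R n) (P Q : point R n -> Prop) :
  nbhd y P -> nbhd y Q -> nbhd y (fun y' => P y' /\ Q y').
Proof.
move=> [a a0 ha] [b b0 hb]; exists (Num.min a b); first by rewrite lt_min a0 b0.
move=> y' near; split; [apply: ha|apply: hb]; apply: near_pt_le near.
  by rewrite ge_min lexx.
by rewrite ge_min lexx orbT.
Qed.

Lemma nbhd_lt n (G : point R n -> R) (y : point R n) c :
  polyfun G -> G y < c -> nbhd y (fun y' => G y' < c).
Proof.
move=> pG lt; have e0 : 0 < c - G y by lra.
have [dl dl0 h] := polyfun_continuous y pG e0.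
by exists dl => // y' /h; rewrite ltr_norml => /andP[_]; lra.
Qed.

Lemma nbhd_norm_lt n (G : point R n -> R) (y : point R n) c :
  polyfun G -> `|G y| < c -> nbhd y (fun y' => `|G y'| < c).
Proof.
rewrite ltr_norml => pG /andP[h1 h2].
have h1' : - G y < c by lra.
have [dl dl0 h] := nbhd_and (nbhd_lt pG h2) (nbhd_lt (polyfunN pG) h1').
by exists dl => // y' /h[? ?]; rewrite ltr_norml; apply/andP; split; lra.
Qed.

Lemma adherent_le n (G : point R n -> R) (y : point R n) c :
  polyfun G ->
  (forall eta dl, 0 < eta -> 0 < dl -> exists2 y', G y' <= c + eta & near_pt dl y y') ->
  G y <= c.
Proof.
move=> pG h; rewrite leNgt; apply/negP => lt.
have e0 : 0 < (G y - c) / 2 by lra.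
have [dl dl0 hc] := polyfun_continuous y pG e0.
have [y' le near] := h _ _ e0 dl0.
by have := hc y' near; rewrite ltr_norml => /andP[]; lra.
Qed.

Lemma closed_le n (G : point R n -> R) c :
  polyfun G -> is_closed (fun y => G y <= c).
Proof.
move=> pG y h; apply: adherent_le => // eta dl eta0 /h[y' [le near]].
by exists y' => //; lra.
Qed.

Lemma closed_and n (P Q : point R n -> Prop) :
  is_closed P -> is_closed Q -> is_closed (fun y => P y /\ Q y).
Proof.
move=> cP cQ y h; split; [apply: cP|apply: cQ] => dl /h[y' [[? ?] ?]]; by exists y'.
Qed.

Lemma closed_all n (T : Type) (P : T -> point R n -> Prop) :
  (forall i, is_closed (P i)) -> is_closed (fun y => forall i, P i y).
Proof. by move=> cP y h i; apply: cP => dl /h[y' [? ?]]; exists y'. Qed.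

Lemma closed_imp n (A : Prop) (P : point R n -> Prop) :
  is_closed P -> is_closed (fun y => A -> P y).
Proof. by move=> cP y h a; apply: cP => dl /h[y' [? ?]]; exists y'; split=> //; auto. Qed.

Lemma closed_eq n (G : point R n -> R) c :
  polyfun G -> is_closed (fun y => G y = c).
Proof.
move=> pG y h; apply: le_anti; apply/andP; split.
  by apply: (@closed_le _ G c pG) => dl /h[y' [<- ?]]; exists y'.
rewrite -lerN2; apply: (@closed_le _ (fun y => - G y) (- c) (polyfunN pG)).
by move=> dl /h[y' [<- ?]]; exists y'.
Qed.

Lemma closed_norm_le n (G : point R n -> R) c :
  polyfun G -> is_closed (fun y => `|G y| <= c).
Proof.
move=> pG y h; rewrite ler_norml; apply/andP; split.
  rewrite lerNl; apply: (@closed_le _ (fun y => - G y) c (polyfunN pG)).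
  move=> dl /h[y' [le ?]]; exists y'; split=> //.
  by move: le; rewrite ler_norml => /andP[]; lra.
apply: (@closed_le _ G c pG) => dl /h[y' [le ?]]; exists y'; split=> //.
by move: le; rewrite ler_norml => /andP[].
Qed.

Lemma sa_norm_lt n (F G : point R n -> R) :
  polyfun F -> polyfun G -> is_semialg (fun y => `|F y| < G y).
Proof.
move=> pF pG.
apply: sa_equiv (sa_and (sa_lt (polyfunN pG) pF) (sa_lt pF pG)) => y.
by rewrite ltr_norml; split=> [[-> ->]|/andP[]].
Qed.

Lemma sa_norm_le n (F G : point R n -> R) :
  polyfun F -> polyfun G -> is_semialg (fun y => `|F y| <= G y).
Proof.
move=> pF pG.
apply: sa_equiv (sa_and (sa_le (polyfunN pG) pF) (sa_le pF pG)) => y.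
by rewrite ler_norml; split=> [[-> ->]|/andP[]].
Qed.

Lemma qf_holds_sign n (phi : qf_formula R n) (z z' : point R n) :
  (forall p, p \in qf_atoms phi -> Num.sg p.@[z] = Num.sg p.@[z']) ->
  (qf_holds phi z <-> qf_holds phi z').
Proof.
elim: phi => [|p|p|p|f IH|f IH1 g IH2|f IH1 g IH2] //= h.
- have /(congr1 (eq_op^~ 0)) /= := h p (mem_head _ _); rewrite !sgr_eq0 => e.
  by split=> /eqP k; apply/eqP; move: k; rewrite e.
- by have e := h p (mem_head _ _); rewrite -sgr_gt0 e sgr_gt0.
- by have e := h p (mem_head _ _); rewrite -sgr_lt0 e sgr_lt0.
- by have := IH h; tauto.
- have h1 : qf_holds f z <-> qf_holds f z'.
    by apply: IH1 => p hp; apply: h; rewrite mem_cat hp.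
  have h2 : qf_holds g z <-> qf_holds g z'.
    by apply: IH2 => p hp; apply: h; rewrite mem_cat hp orbT.
  tauto.
- have h1 : qf_holds f z <-> qf_holds f z'.
    by apply: IH1 => p hp; apply: h; rewrite mem_cat hp.
  have h2 : qf_holds g z <-> qf_holds g z'.
    by apply: IH2 => p hp; apply: h; rewrite mem_cat hp orbT.
  tauto.
Qed.

End Neighbourhoods.

(** * Approximation by critical points *)

Section CriticalPoints.
Variables (R : rcfType) (k d : nat) (iu : 'I_k).

Let w (i : 'I_k) : 'I_k.+1 := widen_ord (leqnSn k) i.

(** On the zeros of [E] the term linear in [zeta] dominates for small [zeta] and favours a small
    [u ^ 2]. The last term exceeds the squares in degree when [E] has degree at most [d], and so
    provides the leading terms of the critical equations. *)
Definition deformation (E : seq {mpoly R[k.+1]}) (zeta : R) : {mpoly R[k.+1]} :=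
  \sum_(p <- E) p ^+ 2 + zeta *: 'X_(w iu) ^+ 2
    + zeta ^+ 2 *: \sum_(i < k) 'X_(w i) ^+ (2 * d + 2).

Lemma meval_deformation E zeta (y : point R k) t :
  (deformation E zeta).@[ext y t] =
  \sum_(p <- E) p.@[ext y t] ^+ 2 + zeta * y iu ^+ 2
    + zeta ^+ 2 * \sum_i y i ^+ (2 * d + 2).
Proof.
rewrite !mevalD !mevalZ !raddf_sum /= rmorphXn /= mevalXU ext_widen.
congr (_ + _ + _ * _); apply: eq_bigr => p _; rewrite rmorphXn //=.
by rewrite mevalXU ext_widen.
Qed.

Lemma shift_ext (y : point R k) t i s :
  shift_coord (ext y t) (w i) s = ext (shift_coord y i s) t.
Proof.
apply: functional_extensionality; apply: ord_widenP => [j|].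
  by rewrite /shift_coord !ext_widen -(inj_eq val_inj) /= (inj_eq val_inj).
rewrite /shift_coord !ext_max -(inj_eq val_inj) /=.
by rewrite gtn_eqF.
Qed.

Variables (L : seq {mpoly R[k.+1]}) (phi : qf_formula R k.+1) (t b : R).
Variable S : point R k -> Prop.
Hypothesis phiL : {subset qf_atoms phi <= L}.
Hypothesis SE : forall y, S y <-> qf_holds phi (ext y t).
Hypothesis S_closed : is_closed S.
Hypothesis S_bounded : forall y, S y -> forall i, `|y i| <= b.

Let val (p : {mpoly R[k.+1]}) (y : point R k) : R := p.@[ext y t].

Let polyfun_val p : polyfun (val p).
Proof.
apply: (polyfun_comp (polyfun_meval p)); apply: polyfun_ext => [i|].
  exact: polyfun_coord.
exact: polyfun_const.
Qed.

Let pf_u2 : polyfun (fun y : point R k => y iu ^+ 2).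
Proof. by apply: polyfunX; apply: polyfun_coord. Qed.

(* Among the points of S minimising [y iu ^+ 2], take ys on which the largest number of
   polynomials of L vanish, and let E be those vanishing at ys.  Then the minimisers in the
   stratum of ys form a compact set K' with a neighbourhood U in which the common zeros of E lie in S.
   Hence minimisers over U of the deformation tend to K' with zeta. *)
Lemma critical_approximation : (exists y, S y) ->
  exists ys, [/\ S ys, (forall y, S y -> ys iu ^+ 2 <= y iu ^+ 2) &
    exists A : pred {mpoly R[k.+1]}, forall eps, 0 < eps -> exists zeta z,
      [/\ 0 < zeta < eps, z ord_max = t,
          (forall i, (mderiv (w i) (deformation (filter A L) zeta)).@[z] = 0)
        & `|z (w iu) ^+ 2 - ys iu ^+ 2| < eps]].
Proof.
move=> neS.
have saS : is_semialg S.
  apply: (@sa_equiv _ _ (fun y => qf_holds phi (ext y t))) => [y|].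
    by rewrite SE.
  apply: (sa_comp (sa_holds phi)); apply: polyfun_ext => [i|].
    exact: polyfun_coord.
  exact: polyfun_const.
have [y0 Sy0 y0min] := polyfun_min_attained saS S_closed neS S_bounded pf_u2.
set m2 := y0 iu ^+ 2 in y0min.
pose K y := S y /\ y iu ^+ 2 = m2.
have [ys [Sys ysm] ysmin] := @ex_min_nat _ K (fun y => count (fun p => val p y != 0) L)
  (ex_intro _ y0 (conj Sy0 erefl)).
exists ys; split=> [//|y /y0min|]; first by rewrite ysm.
rewrite ysm; pose A p := val p ys == 0; exists A.
pose sgn p := Num.sg (val p ys).
(* The sign conditions are weak, which makes [K'] closed. The extremal choice of [ys] makes them
   strict for the polynomials not vanishing at [ys], since another zero would give a point of [K]
   with more vanishing polynomials. *)
pose K' y := [/\ K y, (forall p, p \in filter A L -> val p y = 0)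
  & forall p, p \in L -> 0 <= sgn p * val p y].
have K'pos y p : K' y -> p \in L -> val p ys != 0 -> 0 < sgn p * val p y.
  move=> [Ky z0 nn] pL ps; rewrite lt0r nn // andbT mulf_neq0 ?sgr_eq0 //.
  apply/negP => /eqP py; have := ysmin y Ky; rewrite leqNgt => /negP; apply.
  apply: count_lt pL ps _ => [q qL|]; last by rewrite py eqxx.
  by apply: contraNneq => qs; rewrite z0 // mem_filter /A qs eqxx.
have K'ys : K' ys.
  split=> // [p|p _]; first by rewrite mem_filter => /andP[/eqP].
  by rewrite /sgn -normrEsg.
have pf_sv p : polyfun (fun y => sgn p * val p y).
  by apply: polyfunM; [apply: polyfun_const|apply: polyfun_val].
have saK' : is_semialg K'.
  have h1 : is_semialg K.
    by apply: sa_and => //; apply: sa_eq => //; apply: polyfun_const.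
  have h2 : is_semialg (fun y => forall p, p \in filter A L -> val p y = 0).
    apply: sa_all_seq => p; apply: sa_eq; [exact: polyfun_val|exact: polyfun_const].
  have h3 : is_semialg (fun y => forall p, p \in L -> 0 <= sgn p * val p y).
    by apply: sa_all_seq => p; apply: sa_le => //; apply: polyfun_const.
  by apply: sa_equiv (sa_and h1 (sa_and h2 h3)) => y; split=> [[? []]|[]].
have cK' : is_closed K'.
  have h1 : is_closed K by apply: closed_and => //; apply: closed_eq.
  have h2 : is_closed (fun y => forall p, p \in filter A L -> val p y = 0).
    by apply: closed_all => p; apply: closed_imp; apply: closed_eq; apply: polyfun_val.
  have h3 : is_closed (fun y => forall p, p \in L -> - (sgn p * val p y) <= 0).
    by apply: closed_all => p; apply: closed_imp; apply: closed_le; apply: polyfunN.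
  have := closed_and h1 (closed_and h2 h3) => h y hy.
  have [? [? h']] : K y /\ (forall p, p \in filter A L -> val p y = 0) /\
      (forall p, p \in L -> - (sgn p * val p y) <= 0).
    apply: h => dl /hy[y' [[? ? h'] near]]; exists y'; split=> //; split=> //; split=> // p pL.
    by rewrite oppr_le0 h'.
  by split=> // p pL; rewrite -oppr_le0 h'.
have bK' y : K' y -> forall i, `|y i| <= b by move=> [[Sy _] _ _]; apply: S_bounded.
have [||rho rho0 hrho] := @pos_uniform R _ L (fun p c => val p ys != 0 ->
    forall y, K' y -> c <= sgn p * val p y).
- by move=> p c c' /andP[_ le] h ps y Ky; apply: le_trans le _; apply: h.
- move=> p pL; have [ps|ps] := eqVneq (val p ys) 0; first by exists 1.
  have [y1 Ky1 y1min] := polyfun_min_attained saK' cK' (ex_intro _ ys K'ys) bK' (pf_sv p).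
  by exists (sgn p * val p y1) => //; apply: K'pos.
(* [U] is compact and hosts the minimisation; its open version [Uo] leaves room to move along each
   coordinate. Both [rho / 2] and [b + 1] leave a margin around [K']. *)
pose U y := (forall p, p \in L -> val p ys != 0 -> rho / 2 <= sgn p * val p y) /\
  forall i, `|y i| <= b + 1.
pose Uo y := (forall p, p \in L -> val p ys != 0 -> rho / 2 < sgn p * val p y) /\
  forall i, `|y i| < b + 1.
have K'Uo y : K' y -> Uo y.
  move=> Ky; split=> [p pL ps|i]; first by have := hrho p pL ps y Ky; lra.
  by have := bK' y Ky i; lra.
have UoU y : Uo y -> U y.
  by move=> [h1 h2]; split=> [p pL ps|i]; apply: ltW; [apply: h1|apply: h2].
have nbhdUo y : Uo y -> nbhd y Uo.
  move=> [h1 h2]; apply: nbhd_and; last first.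
    by apply: nbhd_all => i; apply: nbhd_norm_lt => //; apply: polyfun_coord.
  apply: nbhd_all_seq => p pL; have [ps|ps] := eqVneq (val p ys) 0.
    by exists 1.
  have lt : - (sgn p * val p y) < - (rho / 2) by have := h1 p pL ps; lra.
  have [dl dl0 h] := nbhd_lt (polyfunN (pf_sv p)) lt.
  by exists dl => // y' /h; lra.
have saU : is_semialg U.
  apply: sa_and.
    apply: sa_all_seq => p; apply: sa_imp; last by apply: sa_le => //; apply: polyfun_const.
    by case: (val p ys != 0); [apply: sa_equiv (saT R k)|apply: sa_equiv (sa_not (saT R k)) => y; split].
  by apply: sa_all_fin => i; apply: sa_norm_le; [apply: polyfun_coord|apply: polyfun_const].
have saUo : is_semialg Uo.
  apply: sa_and.
    apply: sa_all_seq => p; apply: sa_imp; last by apply: sa_lt => //; apply: polyfun_const.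
    by case: (val p ys != 0); [apply: sa_equiv (saT R k)|apply: sa_equiv (sa_not (saT R k)) => y; split].
  by apply: sa_all_fin => i; apply: sa_norm_lt; [apply: polyfun_coord|apply: polyfun_const].
have cU : is_closed U.
  apply: closed_and; last by apply: closed_all => i; apply: closed_norm_le; apply: polyfun_coord.
  apply: closed_all => p; apply: closed_imp; apply: closed_imp => y h.
  rewrite -lerN2; apply: (closed_le (polyfunN (pf_sv p))) => dl /h[y' [le near]].
  by exists y'; split=> //; rewrite lerN2.
(* In [U] the polynomials outside [E] keep the sign they have at [ys], and on the zeros of [E] the
   others agree as well. *)
have US y : U y -> (forall p, p \in filter A L -> val p y = 0) -> S y.
  move=> [h1 _] h0; apply/SE; apply/(qf_holds_sign (z' := ext ys t)); last exact/SE.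
  move=> p /phiL pL; have [ps|ps] := eqVneq (val p ys) 0.
    by rewrite -!/(val _ _) ps h0 // mem_filter /A ps eqxx.
  have pos : 0 < sgn p * val p y by have := h1 p pL ps; lra.
  have : Num.sg (sgn p * val p y) = 1 by rewrite gtr0_sg.
  rewrite sgrM /sgn sgr_id -!/(val _ _).
  have [lt|gt|e0] := ltgtP (val p ys) 0; last by rewrite e0 eqxx in ps.
    by rewrite (ltr0_sg lt) mulN1r => /eqP; rewrite eqr_oppLR => /eqP.
  by rewrite (gtr0_sg gt) mul1r.
pose F y := \sum_(p <- filter A L) val p y ^+ 2.
pose H (y : point R k) := \sum_i y i ^+ (2 * d + 2).
have F0 y : 0 <= F y by apply: sumr_ge0 => p _; apply: sqr_ge0.
have H0 y : 0 <= H y.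
  apply: sumr_ge0 => i _; rewrite (_ : 2 * d + 2 = d.+1 * 2)%N; last lia.
  by rewrite exprM sqr_ge0.
have pfF : polyfun F by apply: polyfun_sum => p; apply: polyfunX.
have pfH : polyfun H by apply: polyfun_sum => i; apply: polyfunX; apply: polyfun_coord.
pose Psi zeta y := F y + zeta * y iu ^+ 2 + zeta ^+ 2 * H y.
have PsiE zeta y : (deformation (filter A L) zeta).@[ext y t] = Psi zeta y.
  exact: meval_deformation.
have Fys : F ys = 0.
  rewrite /F big_seq big1 // => p; rewrite mem_filter => /andP[/eqP-> _].
  by rewrite expr0n.
move=> eps eps0.
have [z0 z00 hz0] : exists2 z0, 0 < z0 & forall zeta y, 0 < zeta <= z0 -> U y ->
    Psi zeta y <= Psi zeta ys -> Uo y /\ `|y iu ^+ 2 - m2| < eps.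
  (* Otherwise, as [zeta] tends to [0], points no worse than [ys] but outside [Uo] or with a wrong
     [u ^ 2] accumulate at some [yo]. Then [yo] lies in [K'], and a whole neighbourhood of it
     consists of good points. *)
  apply: NNPP => nz.
  pose C e y := [/\ U y, ~ (Uo y /\ `|y iu ^+ 2 - m2| < eps)
    & exists zeta, [/\ 0 < zeta, zeta <= e & Psi zeta y <= Psi zeta ys]].
  have [|e e0|e y _ [[]] //|e e' y _ le [Uy nU [zeta [? ? ?]]]|yo hyo] := @sa_compact R k C (b + 1).
  - have pfr i : polyfun (fun z : point R k.+1 => front z i) by apply: polyfun_coord.
    have h1 := sa_comp saU pfr.
    have h2 : is_semialg (fun z : point R k.+1 =>
        ~ (Uo (front z) /\ `|front z iu ^+ 2 - m2| < eps)).
      apply: sa_not; apply: sa_and; first exact: sa_comp saUo pfr.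
      apply: sa_norm_lt; last exact: polyfun_const.
      by apply: polyfunD; [apply: polyfunX|apply: polyfun_const].
    have h3 : is_semialg (fun z : point R k.+1 => exists zeta,
        [/\ 0 < zeta, zeta <= z ord_max & Psi zeta (front z) <= Psi zeta ys]).
      apply: (sa_exists (T := fun (z : point R k.+1) zeta =>
        [/\ 0 < zeta, zeta <= z ord_max & Psi zeta (front z) <= Psi zeta ys])).
      have pl : polyfun (fun x : point R k.+2 => x ord_max) by apply: polyfun_coord.
      have pff i : polyfun (fun x : point R k.+2 => front (front x) i) by apply: polyfun_coord.
      have g1 : is_semialg (fun x : point R k.+2 => 0 < x ord_max).
        by apply: sa_lt => //; apply: polyfun_const.
      have g2 : is_semialg (fun x : point R k.+2 => x ord_max <= front x ord_max).
        by apply: sa_le => //; apply: polyfun_coord.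
      have g3 : is_semialg (fun x : point R k.+2 =>
          Psi (x ord_max) (front (front x)) <= Psi (x ord_max) ys).
        apply: sa_le; rewrite /Psi.
          apply: polyfunD; first apply: polyfunD; first exact: polyfun_comp pfF pff.
            by apply: polyfunM => //; apply: polyfunX.
          by apply: polyfunM; [apply: polyfunX|apply: (polyfun_comp pfH)].
        by do ?[apply: polyfunD|apply: polyfunM|apply: polyfunX|exact: pl|apply: polyfun_const].
      by apply: sa_equiv (sa_and g1 (sa_and g2 g3)) => x; split=> [[? []]|[]].
    by apply: sa_equiv (sa_and h1 (sa_and h2 h3)) => x; split=> [[? []]|[]].
  - apply: NNPP => ne; apply: nz; exists e => // zeta y /andP[z0 ze] Uy le.
    apply: NNPP => nU; apply: ne; exists y; split=> //; exists zeta; split=> //.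
  - by split=> //; exists zeta; split=> //; lra.
  (* Comparison with [ys], where [F] vanishes, bounds [F y] by [zeta * (m2 + zeta * H ys)]; the same
     comparison divided by [zeta] bounds [y iu ^+ 2] by [m2 + zeta * H ys]. *)
  have small eta : 0 < eta -> exists2 e, 0 < e & forall y, C e y ->
      F y <= 0 + eta /\ y iu ^+ 2 <= m2 + eta.
    move=> eta0; have m20 : 0 <= m2 by rewrite /m2 sqr_ge0.
    have M0 : 0 < m2 + H ys + 1 by have := H0 ys; lra.
    have q0 : 0 < eta / (m2 + H ys + 1) by apply: divr_gt0.
    exists (Num.min 1 (eta / (m2 + H ys + 1))); first by rewrite lt_min ltr01.
    move=> y [_ _ [zeta [zp]]]; rewrite le_min => /andP[z1 zq].
    rewrite /Psi Fys ysm => le.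
    have zM : zeta * (m2 + H ys + 1) <= eta by rewrite -ler_pdivlMr.
    have Hy := H0 y; have Hs := H0 ys; have Fy := F0 y.
    have zz : zeta ^+ 2 <= zeta by rewrite expr2 ler_piMl // ltW.
    have zH : zeta ^+ 2 * H ys <= zeta * H ys by apply: ler_wpM2r.
    have zHy : 0 <= zeta ^+ 2 * H y by apply: mulr_ge0 => //; apply: sqr_ge0.
    have zu : 0 <= zeta * y iu ^+ 2 by apply: mulr_ge0; [exact: ltW|exact: sqr_ge0].
    split; first by lra.
    have : zeta * y iu ^+ 2 <= zeta * (m2 + zeta * H ys) by lra.
    rewrite ler_pM2l // => /le_trans; apply.
    have : 0 <= zeta * m2 by apply: mulr_ge0 => //; exact: ltW.
    by lra.
  have Uyo : U yo.
    by apply: cU => dl dl0; have [y' [? _ _] ?] := hyo 1 dl ltr01 dl0; exists y'.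
  have Fyo : F yo = 0.
    apply: le_anti; rewrite F0 andbT; apply: adherent_le => // eta dl /small[e e0 he] dl0.
    by have [y' /he[? _] ?] := hyo e dl e0 dl0; exists y'.
  have uyo : yo iu ^+ 2 <= m2.
    apply: (adherent_le pf_u2) => eta dl /small[e e0 he] dl0.
    by have [y' /he[_ ?] ?] := hyo e dl e0 dl0; exists y'.
  have vyo p : p \in filter A L -> val p yo = 0.
    move=> pE; apply/eqP; rewrite -sqrf_eq0 -/(F yo); apply/eqP.
    have := Fyo; rewrite /F (big_rem p pE) /= => /eqP.
    rewrite paddr_eq0 ?sqr_ge0 //; last by apply: sumr_ge0 => q _; apply: sqr_ge0.
    by move=> /andP[/eqP].
  have Syo := US yo Uyo vyo.
  have K'yo : K' yo.
    split=> //; first by split=> //; apply: le_anti; rewrite uyo y0min.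
    move=> p pL; have [ps|ps] := eqVneq (val p ys) 0.
      by rewrite /sgn ps sgr0 mul0r.
    by have := Uyo.1 p pL ps; lra.
  have nn : nbhd yo (fun y => Uo y /\ `|y iu ^+ 2 - m2| < eps).
    apply: nbhd_and; first by apply: nbhdUo; apply: K'Uo.
    apply: (@nbhd_norm_lt _ _ (fun y => y iu ^+ 2 - m2)).
      by apply: polyfunD => //; apply: polyfun_const.
    by case: K'yo => -[_ ->] _ _; rewrite subrr normr0.
  have [dl dl0 hdl] := nn.
  by have [y' [_ nU _] near] := hyo 1 dl ltr01 dl0; apply: nU; apply: hdl.
pose zeta := Num.min z0 (eps / 2).
have zeta0 : 0 < zeta by rewrite lt_min z00 /=; lra.
have zeta_eps : zeta < eps.
  by apply: (@le_lt_trans _ _ (eps / 2)); [rewrite ge_min lexx orbT|lra].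
have Uys : U ys by apply: UoU; apply: K'Uo.
have pfPsi : polyfun (Psi zeta).
  by apply: polyfunD; first apply: polyfunD => //; apply: polyfunM => //; apply: polyfun_const.
have [y Uy ymin] := polyfun_min_attained saU cU (ex_intro _ ys Uys) (fun y Uy => Uy.2) pfPsi.
have [|Uoy uy] := hz0 zeta y _ Uy (ymin ys Uys).
  by rewrite zeta0 ge_min lexx.
exists zeta, (ext y t); split; rewrite ?ext_max ?ext_widen ?zeta0 ?zeta_eps //.
(* The minimiser lies in [Uo], so small moves along a coordinate stay in [U] and Fermat's criterion
   applies. *)
move=> i; have [dl dl0 hdl] := nbhdUo y Uoy.
apply: (mderiv_local_min dl0) => s sdl.
rewrite shift_ext !PsiE; apply: ymin; apply: UoU; apply: hdl => j.
rewrite /shift_coord; case: eqP => _.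
  by rewrite opprD addrA subrr sub0r normrN.
by rewrite subrr normr0.
Qed.

End CriticalPoints.

(** * Degree bounds *)

Section Degrees.
Variable R : rcfType.

Lemma msize_sum_le n (I : eqType) (r : seq I) (F : I -> {mpoly R[n]}) D :
  (forall i, i \in r -> (msize (F i) <= D)%N) -> (msize (\sum_(i <- r) F i) <= D)%N.
Proof.
move=> h; rewrite big_seq; apply: (big_ind (fun p => msize p <= D)%N).
- by rewrite mmeasure0.
- by move=> p q hp hq; apply: leq_trans (mmeasureD_le _ _ _) _; rewrite geq_max hp hq.
- by move=> i ir; apply: h.
Qed.

Lemma msize_mderiv_le n (p : {mpoly R[n]}) i : (msize (mderiv i p) <= (msize p).-1)%N.
Proof.
rewrite /mderiv; apply: msize_sum_le => m mp.
have [mi0|mi] := posnP (m i); first by rewrite mi0 mul0r scale0r mmeasure0.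
apply: leq_trans (msizeZ_le _ _) _; rewrite msizeX.
have lt := msize_mdeg_lt mp.
suff : (mdeg (m - U_(i)) + 1 = mdeg m)%N by lia.
rewrite -(mdeg1 i) -mdegD; congr mdeg; apply: submK.
by apply/mnm_lepP => j; rewrite mnm1E; case: eqP => [<-|].
Qed.

Definition rename n m (s : 'I_n -> 'I_m) (p : {mpoly R[n]}) : {mpoly R[m]} :=
  p \mPo [tuple 'X_(s i) | i < n].

Lemma meval_rename n m (s : 'I_n -> 'I_m) p (z : point R m) :
  (rename s p).@[z] = p.@[fun i => z (s i)].
Proof.
by rewrite comp_mpoly_meval; apply: meval_eq => i; rewrite tnth_mktuple mevalXU.
Qed.

Lemma msize_rename_le n m (s : 'I_n -> 'I_m) p : (msize (rename s p) <= msize p)%N.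
Proof.
rewrite /rename comp_mpolyEX; apply: msize_sum_le => mm mp.
apply: leq_trans (msizeZ_le _ _) _; rewrite comp_mpolyX.
under eq_bigr do rewrite tnth_mktuple mpolyXn.
rewrite mprodXE msizeX mdeg_sum.
under eq_bigr do rewrite mdegMn mdeg1 mul1n.
by rewrite -mdegE; apply: msize_mdeg_lt.
Qed.

Lemma meval_mderiv_XUn n (i j : 'I_n) m (z : point R n) :
  (mderiv i ('X_j ^+ m)).@[z] = (m * (j == i))%:R * z j ^+ m.-1.
Proof.
elim: m => [|m IH]; first by rewrite expr0 mderivC meval0 mul0r.
rewrite exprS mderivM mevalD !mevalM meval_mderiv_XU IH rmorphXn /= mevalXU !natrM -natr1.
by case: m {IH} => [|m] /=; rewrite ?expr0 ?exprS; ring.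
Qed.

Fixpoint qf_map n m (f : {mpoly R[n]} -> {mpoly R[m]}) (phi : qf_formula R n) :
    qf_formula R m :=
  match phi with
  | QTrue => QTrue R m
  | QEq0 p => QEq0 (f p)
  | QGt0 p => QGt0 (f p)
  | QLt0 p => QLt0 (f p)
  | QNot a => QNot (qf_map f a)
  | QAnd a b => QAnd (qf_map f a) (qf_map f b)
  | QOr a b => QOr (qf_map f a) (qf_map f b)
  end.

Lemma qf_atoms_map n m (f : {mpoly R[n]} -> {mpoly R[m]}) phi :
  qf_atoms (qf_map f phi) = map f (qf_atoms phi).
Proof. by elim: phi => //= a -> b ->; rewrite map_cat. Qed.

Lemma qf_holds_rename n m (s : 'I_n -> 'I_m) phi (z : point R m) :
  qf_holds (qf_map (rename s) phi) z <-> qf_holds phi (fun i => z (s i)).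
Proof.
by elim: phi => [|p|p|p|a IHa|a IHa b IHb|a IHa b IHb] /=;
  rewrite ?meval_rename //; tauto.
Qed.

End Degrees.

(** * Uniform bounds for critical limits *)

Section UniformBound.
Variables (R : rcfType) (k d : nat) (iu : 'I_k).

Let w (i : 'I_k) : 'I_k.+1 := widen_ord (leqnSn k) i.
Let e := (2 * d + 1)%N.
Let tau := (2 * e * (e ^ k) ^ 2)%N.

(** Only [m ^ 2] is approximated, because the minimisation controls [u ^ 2] and not the sign of
    [u]. *)
Definition critical_limit (E : seq {mpoly R[k.+1]}) (t m : R) :=
  forall eps, 0 < eps -> exists zeta z,
    [/\ 0 < zeta < eps, z ord_max = t,
        (forall i, (mderiv (w i) (deformation d iu E zeta)).@[z] = 0)
      & `|z (w iu) ^+ 2 - m ^+ 2| < eps].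

Let D : R := (2 * d + 2)%:R.

Let D_neq0 : D != 0.
Proof. by rewrite pnatr_eq0; lia. Qed.

(** The critical equation in direction [i] has leading term
    [zeta ^ 2 * (2 d + 2) * y_i ^ (2 d + 1)]; it is divided by [D = 2 d + 2]. *)
Lemma perturbed_deformation (E : seq {mpoly R[k.+1]}) zeta z :
  (forall i, (mderiv (w i) (deformation d iu E zeta)).@[z] = 0) ->
  perturbed e (fun i => - D^-1 *: mderiv (w i) (\sum_(p <- E) p ^+ 2))
    (fun i => - D^-1 * (2 * (iu == i))%:R) iu (zeta, z).
Proof.
move=> h i /=; have := h i.
rewrite /deformation !mderivD !mderivZ !mevalD !mevalZ meval_mderiv_XUn.
rewrite [X in _ + _ * X.@[z]](raddf_sum (mderiv (w i))) /= [X in _ + _ * X](raddf_sum (meval z)) /=.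
rewrite (bigD1 i) //= meval_mderiv_XUn eqxx muln1 -/D.
rewrite [X in _ * (_ + X)]big1 ?addr0; last first.
  move=> j ne; rewrite meval_mderiv_XUn (_ : w j == w i = false) ?muln0 ?mul0r //.
  by apply: contraNF ne => /eqP/(congr1 val) /= /val_inj ->.
have -> : (w iu == w i) = (iu == i) by [].
rewrite /= expr1 (_ : (2 * d + 2).-1 = e); last by rewrite /e; lia.
set F' := (mderiv _ _).@[z]; set c := (2 * _)%:R => h0.
have -> : zeta ^+ 2 * z (w i) ^+ e = D^-1 * (zeta ^+ 2 * (D * z (w i) ^+ e)).
  by rewrite mulrCA mulKf.
have -> : zeta ^+ 2 * (D * z (w i) ^+ e) = - F' - zeta * (c * z (w iu)).
  by apply/eqP; rewrite -subr_eq0 -h0; apply/eqP; ring.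
by ring.
Qed.

Lemma critical_limit_bound1 (E : seq {mpoly R[k.+1]}) : (0 < d)%N -> deg_le E d ->
  exists2 c, 0 < c & forall t m, 0 < `|t| < c -> m != 0 -> `|m| <= 1 ->
    critical_limit E t m -> c * `|t| ^+ tau <= `|m|.
Proof.
move=> d0 dE.
pose G i := - D^-1 *: mderiv (w i) (\sum_(p <- E) p ^+ 2).
have e1 : (1 < e)%N by rewrite /e; lia.
have dG i : (msize (G i) <= e.-1)%N.
  apply: leq_trans (msizeZ_le _ _) _; apply: leq_trans (msize_mderiv_le _ _) _.
  rewrite -!subn1 leq_sub2r //; apply: msize_sum_le => p /dE hp.
  have [->|p0] := eqVneq p 0; first by rewrite expr0n mmeasure0.
  by move: hp; rewrite expr2 msizeM // /e; move: (msize p) => s; lia.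
have [q [qn0 hq]] := limit_relation (fun i => - D^-1 * (2 * (iu == i))%:R) iu e1 dG.
have [c c0 [t0 t00 hlow]] := root_lower_bound qn0.
have m0 : 0 < Num.min c t0 by rewrite lt_min c0 t00.
exists (Num.min c t0) => // t m /andP[tp]; rewrite lt_min => /andP[_ tt0] mn0 m1 crit.
(* One of [m] and [- m] is a limit of the coordinates [u] themselves, and the bound sees only the
   absolute value. *)
suff [m' nm' hm'] : exists2 m', `|m'| = `|m| & forall eps, 0 < eps -> exists zeta z,
      [/\ 0 < zeta < eps, perturbed e G (fun i => - D^-1 * (2 * (iu == i))%:R) iu (zeta, z),
      z ord_max = t & `|m' - z (w iu)| < eps].
  rewrite -nm'; apply: (@le_trans _ _ (c * `|t| ^+ tau)).
    by apply: ler_wpM2r; [exact: exprn_ge0|rewrite ge_min lexx].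
  apply: hlow; rewrite ?tp ?nm' //; last exact: hq.
  by rewrite -normr_gt0 nm' normr_gt0.
apply: NNPP => nex.
have bad m' : `|m'| = `|m| -> exists2 eps, 0 < eps & forall zeta z, 0 < zeta < eps ->
   perturbed e G (fun i => - D^-1 * (2 * (iu == i))%:R) iu (zeta, z) ->
   z ord_max = t -> eps <= `|m' - z (w iu)|.
  move=> nm'; apply: NNPP => nb; apply: nex; exists m' => // eps eps0.
  apply: NNPP => nz; apply: nb; exists eps => // zeta z hz pz zt.
  rewrite leNgt; apply/negP => lt; apply: nz; by exists zeta, z.
have [e1' e10 h1] := bad m erefl; have [e2 e20 h2] := bad (- m) (normrN m).
(* If both signs failed, with distances at least [e1'] and [e2], the factorisation of
   [u ^ 2 - m ^ 2] would keep it at least [e1' * e2] in absolute value. *)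
pose eps := Num.min (Num.min e1' e2) (e1' * e2).
have eps0 : 0 < eps by rewrite !lt_min e10 e20 mulr_gt0.
have [zeta [z [/andP[z0 ze] zt /perturbed_deformation pz uz]]] := crit eps eps0.
move: ze; rewrite !lt_min => /andP[/andP[ze1 ze2] _].
have a1 := h1 zeta z; rewrite z0 ze1 in a1; have {}a1 := a1 isT pz zt.
have a2 := h2 zeta z; rewrite z0 ze2 in a2; have {}a2 := a2 isT pz zt.
move: uz; rewrite ltNge => /negP[].
apply: (@le_trans _ _ (e1' * e2)); first by rewrite ge_min lexx orbT.
have -> : z (w iu) ^+ 2 - m ^+ 2 = (m - z (w iu)) * (- m - z (w iu)) by ring.
by rewrite normrM; apply: ler_pM => //; exact: ltW.
Qed.

(** The polynomials vanishing at the minimiser vary with [t], but they form one of the finitely many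
    sublists of [L]. The least of the corresponding constants serves for all [t]. *)
Lemma critical_limit_bound (L : seq {mpoly R[k.+1]}) : (0 < d)%N -> deg_le L d ->
  exists2 c, 0 < c & forall (A : pred {mpoly R[k.+1]}) t m,
    0 < `|t| < c -> m != 0 -> `|m| <= 1 ->
    critical_limit (filter A L) t m -> c * `|t| ^+ tau <= `|m|.
Proof.
move=> d0 dL; pose masks := [seq mask (val b) L | b : (size L).-tuple bool].
have [||c c0 hc] := @pos_uniform R _ masks (fun E c => forall t m,
  0 < `|t| < c -> m != 0 -> `|m| <= 1 -> critical_limit E t m -> c * `|t| ^+ tau <= `|m|).
- move=> E c c' /andP[c'0 le] h t m /andP[t0 tc] mn0 m1 crit.
  apply: (@le_trans _ _ (c * `|t| ^+ tau)); first by apply: ler_wpM2r => //; exact: exprn_ge0.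
  by apply: h => //; rewrite t0 (lt_le_trans tc le).
- move=> E /mapP[b _ ->]; apply: critical_limit_bound1 => // p /mem_mask; exact: dL.
exists c => // A t m; apply: hc; rewrite filter_mask.
have sz : size (map A L) == size L by rewrite size_map.
by apply/mapP; exists (Tuple sz); rewrite ?mem_enum.
Qed.

End UniformBound.

(** * The local inequality *)

Section LocalLojasiewicz.
Variables (R : rcfType) (n d : nat).
Hypothesis d_gt1 : (1 < d)%N.
Variables (Pf Pg : seq {mpoly R[n.+1]}).
Hypotheses (hPf : deg_le Pf d) (hPg : deg_le Pg d).
Variables (A : point R n -> Prop) (f g : point R n -> R).
Hypotheses (hAc : is_closed A) (hfc : continuous_on A f) (hgc : continuous_on A g).
Hypotheses (hfg : is_P_semialg Pf (graph_on A f))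
           (hgg : is_P_semialg Pg (graph_on A g)).
Hypothesis hz : forall x, A x -> f x = 0 -> g x = 0.

Let e := (2 * d + 1)%N.
Let tau := (2 * e * (e ^ n.+1) ^ 2)%N.
Let ww (i : 'I_n) : 'I_n.+2 :=
  widen_ord (leqnSn n.+1) (widen_ord (leqnSn n) i).

Lemma graph_onE (h : point R n -> R) z :
  graph_on A h z <-> A (front z) /\ z ord_max = h (front z).
Proof. by []. Qed.

(** Squaring the cube condition turns an absolute value into one polynomial; its degree, at most
    [2], does not exceed [d]. *)
Definition box_atom (x0 : point R n) (r : R) (i : 'I_n) : {mpoly R[n.+2]} :=
  (r ^+ 2)%:MP - ('X_(ww i) - (x0 i)%:MP) ^+ 2.

Lemma box_atomP x0 r i (x : point R n) u t : 0 < r ->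
  (box_atom x0 r i).@[ext (ext x u) t] < 0 <-> r < `|x i - x0 i|.
Proof.
move=> r0; rewrite /box_atom mevalB mevalC rmorphXn /= mevalB mevalXU mevalC !ext_widen.
by rewrite subr_lt0 -(real_normK (num_real (x i - x0 i))) ltr_pXn2r ?nnegrE ?(ltW r0) ?normr_ge0.
Qed.

Lemma msize_box_atom x0 r i : (msize (box_atom x0 r i) <= d.+1)%N.
Proof.
have C c : (msize (c%:MP : {mpoly R[n.+2]}) <= 1)%N.
  by rewrite mmeasureC; case: (c != 0).
apply: leq_trans (mmeasureD_le _ _ _) _; rewrite geq_max mmeasureN.
apply/andP; split; first by apply: leq_trans (C _) _.
set q := 'X_(ww i) - _.
have hq : (msize q <= 2)%N.
  apply: leq_trans (mmeasureD_le _ _ _) _; rewrite geq_max mmeasureN.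
  by rewrite msizeX mdeg1 /= (leq_trans (C _)).
have [->|q0] := eqVneq q 0; first by rewrite expr0n mmeasure0.
by rewrite expr2 msizeM //; move: hq d_gt1; move: (msize q) => s; lia.
Qed.

Definition box_formula (x0 : point R n) (r : R) : qf_formula R n.+2 :=
  foldr (fun i phi => QAnd (QNot (QLt0 (box_atom x0 r i))) phi) (QTrue R n.+2)
    (enum 'I_n).

Lemma box_formulaP x0 r (x : point R n) u t : 0 < r ->
  qf_holds (box_formula x0 r) (ext (ext x u) t) <-> forall i, `|x i - x0 i| <= r.
Proof.
move=> r0.
have H (s : seq 'I_n) : qf_holds (foldr (fun i phi => QAnd (QNot (QLt0 (box_atom x0 r i))) phi)
    (QTrue R n.+2) s) (ext (ext x u) t) <-> forall i, i \in s -> `|x i - x0 i| <= r.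
  elim: s => [|i s IH] //=; have hi := @box_atomP x0 r i x u t r0.
  split=> [[h1 /IH h2] j|h].
    rewrite inE => /orP[/eqP->|/h2] //.
    by rewrite leNgt; apply/negP => lt; apply: h1; apply/hi.
  split; first by move=> /hi; apply/negP; rewrite -leNgt h ?mem_head.
  by apply/IH => j js; apply: h; rewrite inE js orbT.
by rewrite /box_formula H; split=> h i *; apply: h; rewrite ?mem_enum.
Qed.

Lemma deg_box_formula x0 r : deg_le (qf_atoms (box_formula x0 r)) d.
Proof.
rewrite /box_formula; elim: (enum _) => [|i s IH] p //=.
by rewrite inE => /orP[/eqP->|/IH] //; exact: msize_box_atom.
Qed.

(** On the part of the fibre of [g] through [x] in a cube around [x0], [|f|] attains a minimum
    [|m| <= |f x|], and [m] is a critical limit for [t = g x]. The list [L] of atoms does not depend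
    on [t], hence neither does [c]. *)
Lemma local_lojasiewicz x0 : A x0 -> f x0 = 0 ->
  exists2 c, 0 < c & forall x, A x -> near_pt c x0 x -> 0 < `|g x| < c ->
    c * `|g x| ^+ tau <= `|f x|.
Proof.
move=> Ax0 fx0.
have [dl dl0 hdl] := hfc Ax0 ltr01; rewrite fx0 in hdl.
(* Half the radius keeps the closed cube inside the region where [|f| < 1]. *)
pose r := dl / 2; have r0 : 0 < r by rewrite /r; lra.
have [phif [subf hphif]] := hfg; have [phig [subg hphig]] := hgg.
(* The variables are ordered as [x], [u], [t]: [sf] omits [t] for the graph of [f], and [sg] skips
   [u] for the graph of [g]. *)
pose sf (i : 'I_n.+1) : 'I_n.+2 := widen_ord (leqnSn n.+1) i.
pose sg (i : 'I_n.+1) : 'I_n.+2 := lift (sf ord_max) i.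
pose phi := QAnd (qf_map (rename sf) phif)
  (QAnd (qf_map (rename sg) phig) (box_formula x0 r)).
pose L := qf_atoms phi.
have dL : deg_le L d.
  move=> p; rewrite /L /= !mem_cat !qf_atoms_map => /or3P[/mapP[q /subf/hPf hq ->]|
    /mapP[q /subg/hPg hq ->]|/deg_box_formula //];
  exact: leq_trans (msize_rename_le _ _) hq.
have sgE (x : point R n) u t : (fun i => ext (ext x u) t (sg i)) = ext x t.
  apply: functional_extensionality; apply: ord_widenP => [i|].
    have -> : sg (widen_ord (leqnSn n) i) = sf (widen_ord (leqnSn n) i).
      by apply: val_inj; rewrite /= /bump leqNgt ltn_ord.
    by rewrite !ext_widen.
  have -> : sg ord_max = ord_max by apply: val_inj; rewrite /= /bump leqnn.
  by rewrite !ext_max.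
pose S t (y : point R n.+1) := [/\ A (front y), y ord_max = f (front y),
  g (front y) = t & forall i, `|front y i - x0 i| <= r].
have SE t y : S t y <-> qf_holds phi (ext y t).
  have h1 := qf_holds_rename sf phif (ext y t).
  have h2 := qf_holds_rename sg phig (ext y t).
  have e1 : (fun i => ext y t (sf i)) = y.
    by apply: functional_extensionality => i; rewrite ext_widen.
  have e2 : (fun i => ext y t (sg i)) = ext (front y) t.
    by rewrite -{1}(ext_front y) sgE.
  have h3 : qf_holds (box_formula x0 r) (ext y t) <->
      forall i, `|front y i - x0 i| <= r.
    by rewrite -{1}(ext_front y); apply: box_formulaP.
  rewrite e1 in h1; rewrite e2 in h2.
  have f1 := hphif y; have g1 := hphig (ext (front y) t).
  rewrite graph_onE in f1; rewrite graph_onE front_ext ext_max in g1.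
  rewrite /phi /= /S; split.
    move=> [a1 a2 a3 a4]; split; first by apply/h1; apply/f1.
    by split; [apply/h2; apply/g1|exact: (proj2 h3)].
  move=> [/h1/f1[a1 a2] [/h2/g1[_ tg] a4]]; split=> //; exact: (proj1 h3 a4).
have f_le1 x : A x -> (forall i, `|x i - x0 i| <= r) -> `|f x| <= 1.
  move=> Ax hx; have := hdl x Ax; rewrite subr0 => h; apply/ltW; apply: h => i.
  by rewrite distrC; apply: le_lt_trans (hx i) _; rewrite /r; lra.
have [b0 b00 hb0] := point_bounded x0.
pose b := b0 + r + 1.
have Sb t y : S t y -> forall i, `|y i| <= b.
  move=> [Ay yf _ hy]; apply: ord_widenP => [i|].
    have := hy i; rewrite -[y _]/(front y i) => h.
    have -> : front y i = (front y i - x0 i) + x0 i by ring.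
    by apply: le_trans (ler_normD _ _) _; rewrite /b; have := hb0 i; lra.
  by rewrite yf; apply: le_trans (f_le1 _ Ay hy) _; rewrite /b; lra.
have near_front dl' (y y' : point R n.+1) : near_pt dl' y y' -> near_pt dl' (front y) (front y').
  by move=> near i; apply: near.
have eq_lim (a a' : R) : (forall eps, 0 < eps -> `|a - a'| < eps) -> a = a'.
  move=> h; apply/eqP; rewrite -subr_eq0 -normr_eq0; apply: contraT => ne.
  have : 0 < `|a - a'| by rewrite lt0r ne normr_ge0.
  by move=> /h; rewrite ltxx.
have Sc t : is_closed (S t).
  move=> y hy.
  have Ay : A (front y).
    apply: hAc => dl' /hy[y' [[Ay' _ _ _] near]]; exists (front y'); split=> //.
    exact: near_front.
  split=> //.
  - apply: eq_lim => eps eps0; have e20 : 0 < eps / 2 by lra.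
    have [d1 d10 h1] := hfc Ay e20.
    have m0 : 0 < Num.min d1 (eps / 2) by rewrite lt_min d10.
    have [y' [[Ay' yf _ _] near]] := hy _ m0.
    have n1 : near_pt d1 (front y) (front y').
      by apply: near_front; apply: near_pt_le near; rewrite ge_min lexx.
    have n2 : `|y ord_max - y' ord_max| < eps / 2.
      by apply: lt_le_trans (near ord_max) _; rewrite ge_min lexx orbT.
    have := h1 _ Ay' n1; rewrite -yf => n3.
    have -> : y ord_max - f (front y) =
       (y ord_max - y' ord_max) + (y' ord_max - f (front y)) by ring.
    by apply: le_lt_trans (ler_normD _ _) _; lra.
  - apply: eq_lim => eps eps0; have [d1 d10 h1] := hgc Ay eps0.
    have [y' [[Ay' _ yg _] near]] := hy _ d10.
    by have := h1 _ Ay' (near_front _ _ _ near); rewrite yg distrC.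
  - move=> i.
    have pf : polyfun (fun y : point R n.+1 => front y i - x0 i).
      by apply: polyfunD; [apply: polyfun_coord|apply: polyfun_const].
    apply: (closed_norm_le (c := r) pf) => dl' /hy[y' [[_ _ _ h] near]].
    by exists y'.
have d0 : (0 < d)%N by apply: ltnW.
have [c c0 hc] := critical_limit_bound (ord_max : 'I_n.+1) d0 dL.
have m0 : 0 < Num.min c r by rewrite lt_min c0 r0.
exists (Num.min c r) => // x Ax near /andP[g0]; rewrite lt_min => /andP[gc _].
have Sx : S (g x) (ext x (f x)).
  rewrite /S front_ext ext_max; split=> // i; rewrite distrC; apply: ltW.
  by apply: lt_le_trans (near i) _; rewrite ge_min lexx orbT.
have [ys [Sys ysmin [P hP]]] := critical_approximation d (ord_max : 'I_n.+1)
  (fun p (hp : p \in L) => hp) (SE (g x)) (@Sc (g x)) (@Sb (g x)) (ex_intro _ _ Sx).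
have [Ays ysf ysg hys] := Sys.
set m := ys ord_max in ysf ysmin hP.
(* A zero of [f] on this fibre would be a zero of [g], but [g] has the nonzero value [g x] there. *)
have mn0 : m != 0.
  apply/eqP => m00; move: g0; rewrite -ysg (hz Ays) ?normr0 ?ltxx //.
  by rewrite -ysf.
have m1 : `|m| <= 1 by rewrite ysf; apply: f_le1.
have low := hc P (g x) m; rewrite g0 gc in low.
have {}low := low isT mn0 m1 hP.
apply: (@le_trans _ _ (c * `|g x| ^+ tau)).
  by apply: ler_wpM2r; [exact: exprn_ge0|rewrite ge_min lexx].
apply: le_trans low _.
have := ysmin _ Sx; rewrite ext_max -(real_normK (num_real m)) -(real_normK (num_real (f x))).
by rewrite ler_pXn2r // nnegrE.
Qed.

End LocalLojasiewicz.

(** * Continuity of the quotient and the exponent *)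

Section Continuity.
Variables (R : rcfType) (n : nat) (A : point R n -> Prop).

Definition continuous_at (f : point R n -> R) (x : point R n) :=
  forall eps, 0 < eps -> exists2 delta, 0 < delta &
    forall y, A y -> near_pt delta x y -> `|f y - f x| < eps.

Lemma continuous_at_polyfun2 (F : point R 2 -> R) (f g : point R n -> R) x :
  polyfun F -> continuous_at f x -> continuous_at g x ->
  continuous_at (fun y => F (ext (ext (fun=> 0) (f y)) (g y))) x.
Proof.
move=> pF cf cg eps /(polyfun_continuous (ext (ext (fun=> 0) (f x)) (g x)) pF)[dl dl0 h].
have [d1 d10 h1] := cf dl dl0; have [d2 d20 h2] := cg dl dl0.
exists (Num.min d1 d2) => [|y Ay near]; first by rewrite lt_min d10.
apply: h; apply: near_pt_ext; last first.
  rewrite distrC; apply: h2 => //; apply: near_pt_le near.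
  by rewrite ge_min lexx orbT.
apply: near_pt_ext; first by move=> [].
by rewrite distrC; apply: h1 => //; apply: near_pt_le near; rewrite ge_min lexx.
Qed.

Lemma continuous_at_inv (f : point R n -> R) x : f x != 0 ->
  continuous_at f x -> continuous_at (fun y => (f y)^-1) x.
Proof.
move=> fx0 cf eps eps0.
have n0 : 0 < `|f x| by rewrite normr_gt0.
have q0 : 0 < eps * (`|f x| ^+ 2) / 2.
  by apply: divr_gt0 => //; apply: mulr_gt0 => //; apply: exprn_gt0.
have m0 : 0 < Num.min (`|f x| / 2) (eps * (`|f x| ^+ 2) / 2).
  by rewrite lt_min q0 andbT; lra.
have [dl dl0 h] := cf _ m0; exists dl => // y Ay near.
have := h y Ay near; rewrite lt_min => /andP[h1 h2].
have hy : `|f x| / 2 < `|f y|.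
  have := ler_normB (f y) (f y - f x).
  by rewrite (_ : f y - (f y - f x) = f x); [lra|ring].
have fy0 : f y != 0 by rewrite -normr_gt0; lra.
have -> : (f y)^-1 - (f x)^-1 = (f x - f y) / (f x * f y).
  by field; rewrite fx0 fy0.
rewrite normrM normfV distrC ltr_pdivrMr; last by rewrite normr_gt0 mulf_neq0.
apply: lt_le_trans h2 _; rewrite normrM -mulrA ler_pM2l // expr2 -mulrA.
by rewrite ler_pM2l // ltW.
Qed.

End Continuity.

(** Both [2] and [2 d + 1] are at most [8 d], which gives the exponent [2 n + 4], less than
    [2 n + 14]. *)
Lemma exponent_bound n d : (1 < d)%N ->
  (2 * (2 * d + 1) * (((2 * d + 1) ^ n.+1) ^ 2) < (8 * d) ^ (2 * (n + 7)))%N.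
Proof.
move=> d1; apply: (@leq_ltn_trans ((8 * d) ^ (1 + 1 + (n.+1 * 2))))%N.
  rewrite -expnM !expnD !expn1 leq_mul //; first by rewrite leq_mul //; lia.
  by rewrite leq_exp2r; lia.
by rewrite ltn_exp2l; lia.
Qed.

Theorem theorem5p8 (R : rcfType) (n d : nat) (hd : (2 <= d)%N)
  (P : seq {mpoly R[n]}) (Pf Pg : seq {mpoly R[n.+1]})
  (hP : deg_le P d) (hPf : deg_le Pf d) (hPg : deg_le Pg d)
  (A : point R n -> Prop) (f g : point R n -> R)
  (hA : is_P_semialg P A) (hAc : is_closed A)
  (hfc : continuous_on A f) (hgc : continuous_on A g)
  (hfg : is_P_semialg Pf (graph_on A f)) (hgg : is_P_semialg Pg (graph_on A g))
  (hz : forall x, A x -> f x = 0 -> g x = 0) :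
  let N := ((8 * d) ^ (2 * (n + 7)))%N in
  exists h : point R n -> R,
    [/\ continuous_on A h, is_semialg (graph_on A h)
      & forall x, A x -> g x ^+ N = h x * f x].
Proof.
move=> N.
pose tau := (2 * (2 * d + 1) * (((2 * d + 1) ^ n.+1) ^ 2))%N.
have tauN : (tau < N)%N by exact: exponent_bound.
have N0 : (0 < N)%N by exact: leq_trans tauN.
(* The inverse of [0] is [0], so the quotient vanishes where [f] does. *)
exists (fun x => g x ^+ N / f x); split; last first.
- move=> x Ax; have [fx|fx] := eqVneq (f x) 0.
    by rewrite fx mulr0 (hz x Ax fx) expr0n gtn_eqF.
  by rewrite divfK.
(* The values [u] of [f] and [v] of [g] are quantified; the disjunction expresses the convention for
   division by zero polynomially. *)
- pose T (z : point R n.+1) (u v : R) := [/\ graph_on A f (ext (front z) u),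
     graph_on A g (ext (front z) v) &
     (u = 0 /\ z ord_max = 0) \/ (u <> 0 /\ z ord_max * u = v ^+ N)].
  apply: (@sa_equiv _ _ (fun z => exists u v, T z u v)) => [z|].
    rewrite graph_onE; split=> [[u [v [/graph_onE]]]|[Az zh]].
      rewrite front_ext ext_max => -[Az ->] /graph_onE.
      rewrite front_ext ext_max => -[_ ->] hT; split=> //.
      case: hT => [[-> ->]|[/eqP fz <-]]; first by rewrite invr0 mulr0.
      by rewrite mulfK.
    exists (f (front z)), (g (front z)); split.
    - by apply/graph_onE; rewrite front_ext ext_max.
    - by apply/graph_onE; rewrite front_ext ext_max.
    rewrite zh; have [->|fz] := eqVneq (f (front z)) 0; [left|right].
      by rewrite invr0 mulr0.
    by split; [exact/eqP|rewrite divfK].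
  apply: (sa_exists (T := fun z u => exists v, T z u v)).
  apply: (sa_exists (T := fun (z : point R n.+2) v => T (front z) (z ord_max) v)).
  have hf' : is_semialg (graph_on A f) by exists Pf.
  have hg' : is_semialg (graph_on A g) by exists Pg.
  have h1 : is_semialg (fun z : point R n.+3 =>
      graph_on A f (ext (front (front (front z))) (front z ord_max))).
    apply: (sa_comp hf'); apply: polyfun_ext => [i|]; exact: polyfun_coord.
  have h2 : is_semialg (fun z : point R n.+3 =>
      graph_on A g (ext (front (front (front z))) (z ord_max))).
    apply: (sa_comp hg'); apply: polyfun_ext => [i|]; exact: polyfun_coord.
  have pu : polyfun (fun z : point R n.+3 => front z ord_max) by exact: polyfun_coord.
  have pv : polyfun (fun z : point R n.+3 => z ord_max) by exact: polyfun_coord.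
  have pw : polyfun (fun z : point R n.+3 => front (front z) ord_max).
    exact: polyfun_coord.
  have p0 := polyfun_const n.+3 (0 : R).
  have h3 := sa_or (sa_and (sa_eq pu p0) (sa_eq pw p0))
    (sa_and (sa_not (sa_eq pu p0)) (sa_eq (polyfunM pw pu) (polyfunX N pv))).
  by apply: sa_equiv (sa_and h1 (sa_and h2 h3)) => z; split=> [[? []]|[]].
move=> x Ax; have [fx|fx] := eqVneq (f x) 0; last first.
  have pN : polyfun (fun z : point R 2 => z ord_max ^+ N).
    by apply: polyfunX; apply: polyfun_coord.
  have pM : polyfun (fun z : point R 2 => front z ord_max * z ord_max).
    by apply: polyfunM; apply: polyfun_coord.
  have c1 := continuous_at_polyfun2 pN (hgc x Ax) (hgc x Ax).
  have c2 := continuous_at_inv fx (hfc x Ax).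
  have := continuous_at_polyfun2 pM c1 c2.
  rewrite /continuous_at => h eps /h[dl dl0 hdl]; exists dl => // y Ay near.
  by have := hdl y Ay near; rewrite !front_ext !ext_max.
have gx := hz x Ax fx.
have [c c0 hc] := local_lojasiewicz hd hPf hPg hAc hfc hgc hfg hgg hz Ax fx.
rewrite -/tau in hc.
move=> eps eps0.
(* The bound [1] allows comparing powers of [g y], [c] allows the local inequality, and [c * eps]
   yields [|g y| ^ N / |f y| <= |g y| / c < eps], because [N] is at least [tau + 1]. *)
have m0 : 0 < Num.min (Num.min 1 c) (c * eps).
  by rewrite !lt_min ltr01 c0 mulr_gt0.
have [dl dl0 hdl] := hgc x Ax _ m0.
exists (Num.min dl c) => [|y Ay near]; first by rewrite lt_min dl0.
rewrite fx invr0 mulr0 subr0.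
have := hdl y Ay _; rewrite gx subr0 !lt_min => /(_ _)/andP[].
  by apply: near_pt_le near; rewrite ge_min lexx.
move=> /andP[g1 gc] gce.
have [gy|gy] := eqVneq (g y) 0.
  by rewrite gy expr0n gtn_eqF // mul0r normr0.
have ngy : 0 < `|g y| by rewrite normr_gt0.
have low := hc y Ay (near_pt_le _ near); rewrite ge_min lexx orbT ngy gc in low.
have {}low := low isT isT.
have fy : 0 < `|f y|.
  by apply: lt_le_trans low; apply: mulr_gt0 => //; apply: exprn_gt0.
rewrite normrM normfV normrX ltr_pdivrMr //.
apply: (@le_lt_trans _ _ (`|g y| ^+ tau.+1)).
  by apply: ler_wiXn2l => //; exact: ltW.
apply: lt_le_trans (_ : eps * (c * `|g y| ^+ tau) <= _); last by rewrite ler_pM2l.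
rewrite exprS mulrA ltr_pM2r ?exprn_gt0 //; lra.
Qed.
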